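(* Let $p$ be a prime not equal to $2$, $11$ or $19$, let $T_n$ be the $n$-th Tribonacci number and let $a_n(f)$ be the $n$-th Fourier coefficient of the unique newform $f$ of weight $2$ and level $11$. Then the following are equivalent: (1) $T_{p-1}\equiv 0 \bmod p$. (2) There exist $x$ and $y$ in $\mathbb{Z}$ such that $p=x^2+11y^2$. (3) $a_p(f)\equiv 0 \bmod 2$ and $p\equiv 1,3,4,5$ or $9 \bmod 11$.
   Context: $(T_n)_{n\ge 0}$ denotes the Tribonacci sequence, defined by $T_{n+3}=T_{n+2}+T_{n+1}+T_n$ for $n\ge 0$ and $T_0=0$, $T_1=1$, $T_2=1$. The unique newform of weight $2$ and level $11$ (that is, the unique normalized cusp form in $\mathcal{S}_2(\Gamma_0(11))$) is given explicitly by $f=q\prod_{n=1}^{\infty}(1-q^n)^2(1-q^{11n})^2$, where $q=e^{2\pi i\tau}$; its Fourier coefficients $a_n(f)\in\mathbb{Z}$ are defined by expanding this product as a power series $f=\sum_{n\ge 1}a_n(f)q^n$. *)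

(* Defs.v *)
From mathcomp Require Import all_boot all_order all_algebra.
Set Implicit Arguments.
Unset Strict Implicit.
Unset Printing Implicit Defensive.
Import GRing.Theory.
Local Open Scope ring_scope.

Fixpoint tribonacci (n : nat) : nat :=
  match n with
  | 0 => 0
  | n1.+1 =>
    match n1 with
    | 0 => 1
    | n2.+1 =>
      match n2 with
      | 0 => 1
      | n3.+1 => tribonacci n1 + tribonacci n2 + tribonacci n3
      end
    end
  end%N.

Definition newform11_trunc (N : nat) : {poly int} :=
  'X * \prod_(1 <= k < N.+1) ((1 - 'X^k) ^+ 2 * (1 - 'X^(11 * k)) ^+ 2).

(* The coefficient a_n(f) of q^n in
     f = q * prod_(k >= 1) (1 - q^k)^2 (1 - q^(11k))^2.
   The factors with k > n are congruent to 1 modulo q^(n+1), so the n-th partial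
   product already has the right coefficient: see [newform11_trunc_coef]. *)
Definition newform11_coef (n : nat) : int := (newform11_trunc n)`_n.

Lemma newform11_trunc_coef (n N : nat) :
  (n <= N)%N -> (newform11_trunc N)`_n = newform11_coef n.
Proof.
have coefM1X (q : {poly int}) (k : nat) : (n < k)%N -> (q * (1 - 'X^k))`_n = q`_n.
  by move=> ltnk; rewrite mulrBr mulr1 coefB coefMXn ltnk subr0.
elim: N => [|N IHN]; first by rewrite leqn0 => /eqP->.
rewrite leq_eqVlt ltnS => /predU1P[-> // | leqnN].
have lt1 : (n < N.+1)%N by [].
have lt11 : (n < 11 * N.+1)%N by apply: leq_trans lt1 _; rewrite leq_pmull.
rewrite /newform11_trunc big_nat_recr //= mulrA !expr2 !mulrA.
by rewrite !coefM1X // IHN.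
Qed.

(* Main.v *)
Require Import Defs.
From mathcomp Require Import all_boot all_order all_algebra all_field.
From mathcomp Require Import ring lra zify.
Set Implicit Arguments.
Unset Strict Implicit.
Unset Printing Implicit Defensive.
Import Order.TTheory GRing.Theory Num.Theory.
Local Open Scope ring_scope.

(** All three conditions say that p splits completely in the ring class field of
    Z[sqrt(-11)], which is the splitting field of X^3 - X^2 - X - 1, a polynomial of
    discriminant -44.  The proof makes this explicit without class field theory and
    without modularity: each condition is compared with a representation
    4p = a^2 + 11b^2, and turns out to mean that a is even.

    Such a representation exists as soon as -11 is a square modulo p, because there is a
    single reduced form of discriminant -11 ([norm4_of_sqrt_m11]).  Under (3) the root is
    provided by the Gaussian period of the eleventh roots of unity
    ([sqrt_m11_of_residue]), under (1) by the discriminant of the cubic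
    ([sqrt_m11_of_tribonacci]).  When a is even, so is b, and p = (a/2)^2 + 11(b/2)^2.

    Condition (3).  Modulo 2 the eta product is q prod (1 - q^(2k))(1 - q^(22k)), and the
    pentagonal number theorem shows that a_p(f) counts, modulo 2, the pairs (u, v)
    of positive integers prime to 6 with u^2 + 11v^2 = 12p ([newform11_coef_mod2]).  If
    pi has norm p in the ring of integers of Q(sqrt(-11)), such pairs come from the
    products of pi with the two elements of norm 3 up to sign; both products count if a is even,
    only one does if a is odd ([odd_card_norm12_pairs]).

    Condition (1).  By Binet's formula, T_(p-1) is zero modulo p exactly when Frobenius
    fixes the three roots of the cubic ([tribonacci_dvd_Frobenius]); p = 19 is special
    because there 1/3 is a root.  Once -11 is a square, Frobenius is an even permutation
    of the roots, and whether it is trivial is read on the Lagrange resolvent u, whose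
    cube is 19 + 3 sqrt(-3) sqrt(-11): it is a cubic residue character at p of
    rho = (19b + 3 sqrt(-3) a)/2 in Z[w], w a primitive cube root of unity
    ([Frobenius_cubic_character]).

    This character is evaluated by the cubic reciprocity law between rho and rational
    integers ([cubic_reciprocity]).  The norm of rho is 27p + 16b^2, so modulo rho p is
    -16b^2 up to a cube.  The factor b contributes nothing, because
    rho + conj(rho) = 19b makes rho/conj(rho) equal to -1 at every prime dividing b.  What
    remains is the character at 2, and it is trivial exactly when a is even
    ([cubic_symbol_p_eq0]).  Reciprocity asks for b prime to 3; this is achieved by
    multiplying pi by the cube of an element of norm 3, which changes neither the
    parity of a nor p modulo cubes ([norm_scaled_coprime3]).

    The reciprocity law itself is proved by the classical computation with cubic Gauss
    sums, carried out in a field of characteristic q: the Gauss sum g of a prime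
    l = 1 mod 3 has cube l J, where the Jacobi sum J is an element of Z[w] of
    norm l, and Frobenius multiplies g by a value of the cubic character of l.  General
    elements of Z[w] are then factored by descent on the norm, the Jacobi sums supplying
    the prime factors. *)

(** * Gauss sums over a finite field *)

Section GaussSum.

Variables (k : finFieldType) (F : fieldType) (chi psi : k -> F).
Hypotheses (chi0 : chi 0 = 0) (chiN1 : chi (- 1) = 1).
Hypothesis chiM : forall s t, chi (s * t) = chi s * chi t.
Hypotheses (psi0 : psi 0 = 1) (psi_neq1 : psi 1 != 1).
Hypothesis psiD : forall s t, psi (s + t) = psi s * psi t.

Definition gauss_sum (f : k -> F) := \sum_t f t * psi t.
Definition jacobi_sum := \sum_t chi t * chi (1 - t).

(** Translation by 1 multiplies the sum by psi 1, which is not 1. *)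
Lemma sum_additive_char : \sum_t psi t = 0.
Proof.
have eqS : psi 1 * \sum_t psi t = \sum_t psi t.
  rewrite mulr_sumr [RHS](reindex_inj (addrI 1)).
  by apply: eq_bigr => t _; rewrite psiD.
apply/eqP; move/eqP: eqS; rewrite -subr_eq0 -{2}[\sum__ _]mul1r -mulrBl mulf_eq0.
by rewrite subr_eq0 (negPf psi_neq1).
Qed.

Lemma chiN t : chi (- t) = chi t.
Proof. by rewrite -mulN1r chiM chiN1 mul1r. Qed.

(** The vanishing of the sum of chi^2 takes care of the terms psi s with s = 0. *)
Lemma gauss_sum_sqr : \sum_t chi t ^+ 2 = 0 ->
  gauss_sum chi ^+ 2 = jacobi_sum * gauss_sum (fun t => chi t ^+ 2).
Proof.
move=> sum0; rewrite expr2 /gauss_sum mulr_suml.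
under eq_bigr => t _.
  rewrite mulr_sumr (reindex_inj (addIr (- t))) /=.
  under eq_bigr => s _ do rewrite mulrACA -psiD [t + _]addrC subrK.
  over.
rewrite exchange_big mulr_sumr; apply: eq_bigr => s _.
rewrite -mulr_suml mulrA; congr (_ * _).
have [-> | s0] := eqVneq s 0.
  rewrite chi0 expr0n mulr0 -[RHS]sum0; apply: eq_bigr => t _.
  by rewrite sub0r chiN.
rewrite (reindex_inj (mulfI s0)) /= /jacobi_sum mulr_suml.
apply: eq_bigr => t _.
by rewrite -[X in X - _]mulr1 -mulrBr !chiM; ring.
Qed.

(** Writing t = u c in the double sum separates chi c from an additive sum over u,
    which is #|k| - 1 at c = -1 and -1 elsewhere. *)
Lemma gauss_sumM_inv (chi' : k -> F) : chi' 0 = 0 ->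
    (forall t, t != 0 -> chi t * chi' t = 1) -> \sum_t chi t = 0 ->
  gauss_sum chi * gauss_sum chi' = #|k|%:R.
Proof.
move=> chi'0 chiV sum0.
have sum_psi (d : k) : \sum_(u | u != 0) psi (u * d) = #|k|%:R * (d == 0)%:R - 1.
  have -> : \sum_(u | u != 0) psi (u * d) = \sum_u psi (u * d) - 1.
    by rewrite [in RHS](bigD1 0) //= mul0r psi0 addrAC subrr add0r.
  congr (_ - _); have [-> | d0] := eqVneq d 0.
    under eq_bigr do rewrite mulr0 psi0.
    by rewrite mulr1 sumr_const.
  by rewrite mulr0 -[RHS]sum_additive_char [RHS](reindex_inj (mulIf d0)).
rewrite /gauss_sum mulrC mulr_suml (bigD1 0) //= chi'0 !mul0r add0r.
have eq_term (u : k) : u != 0 ->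
    chi' u * psi u * (\sum_t chi t * psi t) = \sum_t chi t * psi (u * (t + 1)).
  move=> u0; rewrite mulr_sumr (reindex_inj (mulfI u0)); apply: eq_bigr => t _ /=.
  rewrite mulrDr mulr1 psiD chiM.
  by rewrite [LHS](_ : _ = chi u * chi' u * (chi t * (psi (u * t) * psi u)));
    [rewrite chiV // mul1r | ring].
rewrite (eq_bigr _ eq_term) exchange_big /=.
under eq_bigr => t _ do rewrite -mulr_sumr sum_psi mulrBr mulr1 addr_eq0.
rewrite sumrB sum0 subr0 (bigD1 (- 1)) //= eqxx chiN1 mul1r mulr1.
by rewrite big1 ?addr0 // => t /negPf->; rewrite !mulr0.
Qed.

End GaussSum.

Section CubicChar.

Variables (k : finFieldType) (c : k).
Hypotheses (c_root : c ^+ 2 + c + 1 = 0) (k3 : 3%:R != 0 :> k).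

Let e := (#|k|.-1 %/ 3)%N.

(** The discrete logarithm, in base c, of the (#|k| - 1)/3-th power of t: a
    cubic character with values in Z/3, to be transported to any field containing a cube
    root of unity.  Its value at 0 is meaningless. *)
Definition cubic_log (t : k) : 'Z_3 :=
  if t ^+ e == 1 then 0 else if t ^+ e == c then 1 else 2.

Lemma cube_root1 (R : comNzRingType) (w : R) : w ^+ 2 + w + 1 = 0 -> w ^+ 3 = 1.
Proof.
move=> w0; apply/eqP; rewrite -subr_eq0 -[0](mulr0 (w - 1)) -w0.
by apply/eqP; ring.
Qed.

Lemma cube_root_neq1 (R : comNzRingType) (w : R) :
  3%:R != 0 :> R -> w ^+ 2 + w + 1 = 0 -> w != 1.
Proof. by move=> R3 w0; apply: contraNneq R3 => w1; rewrite -w0 w1; apply/eqP; ring. Qed.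

Lemma exprZ3D (R : comNzRingType) (w : R) (i j : 'Z_3) :
  w ^+ 2 + w + 1 = 0 -> w ^+ (i + j)%R = w ^+ i * w ^+ j.
Proof.
by move=> /cube_root1 w3; rewrite -exprD -(expr_mod (i + j)%N w3).
Qed.

Lemma exprZ3_inj (R : comNzRingType) (w : R) (i j : 'Z_3) :
  3%:R != 0 :> R -> w ^+ 2 + w + 1 = 0 -> w ^+ i = w ^+ j -> i = j.
Proof.
move=> R3 w0 eqw.
have wij : w ^+ (i - j)%R = 1.
  have := exprZ3D (i - j) j w0; rewrite subrK eqw.
  have w3 := cube_root1 w0.
  move/(congr1 (fun x => x * w ^+ (- j)%R)).
  by rewrite -mulrA -!(exprZ3D _ _ w0) addrN expr0 addr0 => <-.
apply/eqP; rewrite -subr_eq0; move: (i - j) wij => d.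
have w1 := cube_root_neq1 R3 w0.
case: d => [[|[|[|//]]] //= lt3].
  by rewrite expr1 => w_1; rewrite w_1 eqxx in w1.
move=> w2; move: (cube_root1 w0); rewrite exprS w2 mulr1 => w_1.
by rewrite w_1 eqxx in w1.
Qed.

Lemma cube_root_dvd : (3 %| #|k|.-1)%N.
Proof.
have c1 := cube_root_neq1 k3 c_root; have c3 := cube_root1 c_root.
have c0 : c != 0.
  by apply: contraTneq (oner_neq0 k) => c0; rewrite -c3 c0 expr0n eqxx.
have : c ^+ #|k|.-1 = 1.
  by apply: (mulfI c0); rewrite mulr1 -exprS prednK ?expf_card // ltnW ?finNzRing_gt1.
rewrite -(expr_mod _ c3) /dvdn.
have : (#|k|.-1 %% 3 < 3)%N by rewrite ltn_mod.
case: (_ %% 3)%N => [|[|[|//]]] // _ eqc.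
  by rewrite expr1 in eqc; rewrite eqc eqxx in c1.
by move: c3; rewrite exprS eqc mulr1 => c_1; rewrite c_1 eqxx in c1.
Qed.

Lemma cubic_logP t : t != 0 -> t ^+ e = c ^+ cubic_log t.
Proof.
move=> t0; have t31 : (t ^+ e) ^+ 3 = 1.
  rewrite -exprM divnK ?cube_root_dvd //; apply: (mulfI t0).
  by rewrite mulr1 -exprS prednK ?expf_card // ltnW ?finNzRing_gt1.
rewrite /cubic_log; case: eqP => [-> // | /eqP t1]; case: eqP => [-> // | /eqP tc].
have : (t ^+ e - 1) * (t ^+ e - c) * (t ^+ e - c ^+ 2) = 0.
  set x := t ^+ e in t31 *; have -> : (x - 1) * (x - c) * (x - c ^+ 2) =
    (x ^+ 3 - 1) + (1 - c ^+ 3) * (1 - x) + (c ^+ 2 + c + 1) * (x - x ^+ 2)  by ring.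
  by rewrite t31 c_root (cube_root1 c_root) !subrr !mul0r !addr0.
by move/eqP; rewrite !mulf_eq0 !subr_eq0 (negPf t1) (negPf tc) => /eqP.
Qed.

Lemma cubic_logM s t : s != 0 -> t != 0 ->
  cubic_log (s * t) = cubic_log s + cubic_log t.
Proof.
move=> s0 t0; apply: (exprZ3_inj k3 c_root).
by rewrite exprZ3D // -!cubic_logP ?mulf_neq0 // exprMn.
Qed.

Lemma cubic_log1 : cubic_log 1 = 0.
Proof. by rewrite /cubic_log expr1n eqxx. Qed.

Lemma cubic_logX3 t : t != 0 -> cubic_log (t ^+ 3) = 0.
Proof.
by move=> t0; rewrite !exprS expr0 mulr1 !cubic_logM ?mulf_neq0 //;
  case: (cubic_log t) => [[|[|[|]]] lt] //; apply: val_inj.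
Qed.

Lemma cubic_logN t : t != 0 -> cubic_log (- t) = cubic_log t.
Proof.
move=> t0; rewrite -mulN1r cubic_logM ?oppr_eq0 ?oner_eq0 //.
by rewrite (_ : -1 = (-1) ^+ 3 :> k) ?cubic_logX3 ?oppr_eq0 ?oner_eq0 ?add0r //; ring.
Qed.

Lemma cubic_log_surj : exists2 t, t != 0 & cubic_log t != 0.
Proof.
apply/exists_inP; apply: contraT => /exists_inPn noT.
have e_gt0 : (0 < e)%N.
  rewrite divn_gt0 // dvdn_leq ?cube_root_dvd // -ltnS prednK ?finNzRing_gt1 //.
  by rewrite ltnW ?finNzRing_gt1.
have rootX : all (root ('X^e - 1 : {poly k})) (rem 0 (enum k)).
  apply/allP => t; rewrite mem_rem_uniq ?enum_uniq // !inE mem_enum andbT => t0.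
  move: (noT t t0); rewrite negbK => /eqP kt.
  by rewrite /root !hornerE cubic_logP // kt expr0 subrr.
have X0 : 'X^e - 1 != 0 :> {poly k} by rewrite monic_neq0 // monicXnsubC.
have := max_poly_roots X0 rootX (rem_uniq _ (enum_uniq _)).
rewrite size_XnsubC // size_rem ?mem_enum // -cardE ltnS => le_e.
have eq_e : (e * 3 = #|k|.-1)%N by rewrite divnK ?cube_root_dvd.
by move: le_e e_gt0; rewrite -eq_e; clear; move: e => e1; lia.
Qed.

Section Values.

Variables (F : fieldType) (w : F).
Hypotheses (w_root : w ^+ 2 + w + 1 = 0) (F3 : 3%:R != 0 :> F).

Definition cubic_char t := if t == 0 then 0 else w ^+ cubic_log t.

Lemma cubic_char0 : cubic_char 0 = 0. Proof. by rewrite /cubic_char eqxx. Qed.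

Lemma cubic_charN1 : cubic_char (- 1) = 1.
Proof. by rewrite /cubic_char oppr_eq0 oner_eq0 cubic_logN ?oner_eq0 ?cubic_log1. Qed.

Lemma cubic_charM s t : cubic_char (s * t) = cubic_char s * cubic_char t.
Proof.
rewrite /cubic_char mulf_eq0; case: eqP => /= [_|/eqP s0]; first by rewrite mul0r.
by case: eqP => [_|/eqP t0]; rewrite ?mulr0 // cubic_logM // exprZ3D.
Qed.

Lemma sum_cubic_char : \sum_t cubic_char t = 0.
Proof.
have [s s0 ks] := cubic_log_surj.
have eqS : cubic_char s * (\sum_t cubic_char t) = \sum_t cubic_char t.
  rewrite mulr_sumr [RHS](reindex_inj (mulfI s0)).
  by apply: eq_bigr => t _; rewrite cubic_charM.
apply/eqP; move/eqP: eqS; rewrite -subr_eq0 -{2}[\sum__ _]mul1r -mulrBl mulf_eq0.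
rewrite subr_eq0 /cubic_char (negPf s0).
case: eqP => // eq1; have := exprZ3_inj (i := cubic_log s) (j := 0) F3 w_root eq1.
by move=> ks0; rewrite ks0 in ks.
Qed.

End Values.
End CubicChar.

Lemma finite_extension_root (F : finFieldType) (P : {poly F}) : (1 < size P)%N ->
  exists (K : finFieldType) (f : {rmorphism F -> K}) (x : K), root (map_poly f P) x.
Proof.
move=> P_gt1; have P0 : P != 0 by rewrite -size_poly_gt0 ltnW.
have [L [rs eqP _]] := FinSplittingFieldFor P0.
exists (finvect_type L), (in_alg L : {rmorphism F -> finvect_type L}).
case: rs eqP => [|x rs] eqP.
  have : size P = 1%N.
    by rewrite -(size_map_poly (in_alg L)) (eqp_size eqP) big_nil size_poly1.
  by move=> P1; rewrite P1 in P_gt1.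
by exists x; rewrite (eqp_root eqP) root_prod_XsubC mem_head.
Qed.

(** The orbits all have three elements. *)
Lemma card_free_Z3_action (T : finType) (A : {set T}) (f : T -> T) :
    injective f -> (forall x, (f x \in A) = (x \in A)) ->
    {in A, forall x, f (f (f x)) = x} -> {in A, forall x, f x != x} ->
  (3 %| #|A|)%N.
Proof.
move=> f_inj fA f3 f1.
suffices <- : (fcard f A * 3 = #|A|)%N by rewrite dvdn_mull.
apply: fcard_order_set => //.
  apply/subsetP => x xA; rewrite inE; apply/eqP.
  (* The orbit of x is the cycle x, f x, f (f x), whose entries are distinct. *)
  apply: (@order_cycle _ _ [:: x; f x; f (f x)]); rewrite /= ?inE ?eqxx //.
    by rewrite f3 ?eqxx.
  rewrite !negb_or andbT [x == f x]eq_sym f1 // [f x == _]eq_sym f1 ?fA // !andbT /=.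
  by apply: contraTneq (f1 x xA) => ex; rewrite negbK {1}ex f3.
by move=> x _ /eqP <-; rewrite fA.
Qed.

Section JacobiElement.

Variables (k : finFieldType) (c : k).
Hypotheses (c_root : c ^+ 2 + c + 1 = 0) (k3 : 3%:R != 0 :> k).

Local Notation klog := (cubic_log c).

Definition jacobi_class (i : 'Z_3) :=
  [set t : k | [&& t != 0, 1 - t != 0 & klog (t * (1 - t)) == i]].

(** The Jacobi sum J(chi, chi) of the cubic character, in the coordinates 1 and w of
    Z[w]: grouping the terms by their value gives n0 + n1 w + n2 w^2, and w^2 = -1 - w. *)
Definition jacobi_element : int * int :=
  let n i : int := #|jacobi_class i|%:Z in (n 0 - n 2, n 1 - n 2).

(** In homogeneous form t(1 - t) is the product xyz on the line x + y + z = 0, up to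
    cubes, hence it is invariant under the cyclic permutation t |-> 1/(1 - t) of the
    coordinates.  A fixed point has t(1 - t) = 1, so it lies in class 0.  This
    divisibility is what makes the Jacobi sum congruent to a rational integer modulo 3. *)
Lemma jacobi_class_dvd3 i : i != 0 -> (3 %| #|jacobi_class i|)%N.
Proof.
move=> i0; pose f (t : k) := (1 - t)^-1.
have fE t : t != 0 -> 1 - t != 0 -> 1 - f t = - t / (1 - t).
  by move=> t0 t1; rewrite /f; field.
apply: (@card_free_Z3_action _ _ f).
- by move=> s t /invr_inj/addrI/oppr_inj.
- move=> t; rewrite !inE invr_eq0; have [t0 /=|t0] := eqVneq t 0.
    by rewrite /f t0 subr0 invr1 subrr eqxx andbF.
  have [-> //=|t1 /=] := eqVneq (1 - t) 0.
  rewrite fE // mulf_eq0 oppr_eq0 invr_eq0 (negPf t0) (negPf t1) /=; congr (_ == i).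
  (* t(1 - t) and f t (1 - f t) differ by the cube (t - 1)^3. *)
  rewrite (_ : t * (1 - t) = - ((f t) * (- t / (1 - t)) * (1 - t) ^+ 3)); last first.
    by rewrite /f; field.
  have ft0 : f t != 0 by rewrite invr_eq0.
  have nz : - t / (1 - t) != 0 by rewrite mulf_neq0 ?oppr_eq0 ?invr_eq0.
  have nz3 : (1 - t) ^+ 3 != 0 by rewrite expf_neq0.
  rewrite (cubic_logN c_root k3 (mulf_neq0 (mulf_neq0 ft0 nz) nz3)).
  by rewrite (cubic_logM c_root k3 (mulf_neq0 ft0 nz) nz3) cubic_logX3 // addr0.
- move=> t; rewrite inE => /and3P[t0 t1 _]; rewrite [f (f t)]/f fE //.
  rewrite /f; field; rewrite t1 oppr_eq0 t0 (_ : - t - (1 - t) = - 1); last by ring.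
  by rewrite oppr_eq0 oner_eq0.
- move=> t; rewrite inE => /and3P[t0 t1 kt]; apply: contraNneq i0 => ft.
  rewrite -(eqP kt); suff -> : t * (1 - t) = 1 by rewrite cubic_log1.
  by rewrite -{1}ft /f mulVf.
Qed.

Variables (F : fieldType).

Lemma jacobi_sumE (w : F) : w ^+ 2 + w + 1 = 0 ->
  jacobi_sum (cubic_char c w) =
    jacobi_element.1%:~R + jacobi_element.2%:~R * w.
Proof.
move=> w0; rewrite /jacobi_sum.
have -> : \sum_t cubic_char c w t * cubic_char c w (1 - t) =
    \sum_(t | (t != 0) && (1 - t != 0)) w ^+ klog (t * (1 - t)).
  rewrite [RHS]big_mkcond /=; apply: eq_bigr => t _.
  rewrite /cubic_char; case: eqP => [_|/eqP t0]; first by rewrite mul0r.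
  case: eqP => [_|/eqP t1]; first by rewrite mulr0.
  by rewrite cubic_logM // exprZ3D.
have -> : \sum_(t | (t != 0) && (1 - t != 0)) w ^+ klog (t * (1 - t)) =
    \sum_i #|jacobi_class i|%:R * w ^+ (i : 'Z_3).
  rewrite (partition_big (fun t => klog (t * (1 - t))) predT) //=.
  apply: eq_bigr => i _; rewrite mulr_natl -sumr_const.
  by apply: eq_big => [t|t /andP[_ /eqP->]//]; rewrite inE andbA.
rewrite !big_ord_recl big_ord0 /= /jacobi_element /= !rmorphB /= -!pmulrn.
rewrite (_ : lift _ _ = 1); last exact: val_inj.
rewrite (_ : lift _ _ = 2); last exact: val_inj.
rewrite expr0 expr1 addr0 mulr1 (_ : w ^+ (bump 0 1) = - w - 1) /=; first by ring.
by apply/eqP; rewrite -subr_eq0 -w0; apply/eqP; rewrite /bump /=; ring.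
Qed.

End JacobiElement.

Lemma sqr_mod3 (p : nat) : prime p -> p != 3%N -> (p ^ 2 = 3 * ((p ^ 2).-1 %/ 3) + 1)%N.
Proof.
move=> p_pr p3; have p3' : ~~ (3 %| p)%N by rewrite dvdn_prime2 // eq_sym.
have : ((p * p) %% 3 = 1)%N.
  move: p3'; rewrite -modnMm /dvdn.
  by case: (p %% 3)%N (ltn_pmod p (isT : (0 < 3)%N)) => [|[|[|]]].
have := prime_gt1 p_pr; rewrite -mulnn => p1.
have : (0 < p * p)%N by rewrite muln_gt0 ltnW.
by move: (p * p)%N => q; clear; lia.
Qed.

Section JacobiGauss.

Variables (k : finFieldType) (c : k).
Hypotheses (c_root : c ^+ 2 + c + 1 = 0) (k3 : 3%:R != 0 :> k).
Variables (F : fieldType) (psi : k -> F) (w : F).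
Hypotheses (F3 : 3%:R != 0 :> F) (Fk : #|k|%:R != 0 :> F).
Hypotheses (psi0 : psi 0 = 1) (psi_neq1 : psi 1 != 1).
Hypothesis psiD : forall s t, psi (s + t) = psi s * psi t.
Hypothesis w_root : w ^+ 2 + w + 1 = 0.

Local Notation gauss w := (gauss_sum psi (cubic_char c w)).
Local Notation jacobi w := (jacobi_sum (cubic_char c w)).

Lemma cube_root_sqr (R : comNzRingType) (x : R) :
  x ^+ 2 + x + 1 = 0 -> (x ^+ 2) ^+ 2 + x ^+ 2 + 1 = 0.
Proof. by move=> x0; rewrite -(mulr0 (x ^+ 2 - x + 1)) -x0; ring. Qed.

Lemma cubic_char_sqr (x : F) t : cubic_char c x t ^+ 2 = cubic_char c (x ^+ 2) t.
Proof. by rewrite /cubic_char; case: eqP => _; rewrite ?expr0n // exprAC. Qed.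

Lemma cubic_char_sqr2 t : cubic_char c ((w ^+ 2) ^+ 2) t = cubic_char c w t.
Proof. by congr cubic_char; rewrite -exprM exprS (cube_root1 w_root) mulr1. Qed.

Lemma gauss_cubicM : gauss w * gauss (w ^+ 2) = #|k|%:R.
Proof.
apply: gauss_sumM_inv => //.
- exact: cubic_charN1.
- exact: cubic_charM.
- exact: cubic_char0.
- move=> t t0; rewrite -cubic_char_sqr -exprS /cubic_char (negPf t0).
  by rewrite exprAC (cube_root1 w_root) expr1n.
- exact: sum_cubic_char.
Qed.

Lemma gauss_cubic_sqr (x : F) :
  x ^+ 2 + x + 1 = 0 -> gauss x ^+ 2 = jacobi x * gauss (x ^+ 2).
Proof.
move=> x0; rewrite gauss_sum_sqr //.
- by congr (_ * _); apply: eq_bigr => t _; rewrite cubic_char_sqr.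
- exact: cubic_char0.
- exact: cubic_charN1.
- exact: cubic_charM.
under eq_bigr do rewrite cubic_char_sqr.
by rewrite sum_cubic_char //; apply: cube_root_sqr.
Qed.

Lemma gauss_cubic_conj : gauss ((w ^+ 2) ^+ 2) = gauss w.
Proof. by apply: eq_bigr => t _; rewrite cubic_char_sqr2. Qed.

(** Compare g(w)^2 = J(w) g(w^2), its conjugate, and g(w) g(w^2) = #|k|. *)
Lemma jacobi_cubicM : jacobi w * jacobi (w ^+ 2) = #|k|%:R.
Proof.
have e1 := gauss_cubic_sqr w_root; have := gauss_cubic_sqr (cube_root_sqr w_root).
rewrite gauss_cubic_conj => e2; apply: (mulIf Fk).
rewrite -gauss_cubicM -expr2 exprMn e1 e2; ring.
Qed.

Lemma gauss_cubic_cube : gauss w ^+ 3 = #|k|%:R * jacobi w.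
Proof. by rewrite exprSr gauss_cubic_sqr // -gauss_cubicM; ring. Qed.

(** The q^2-power map fixes the values of chi, since q^2 = 1 mod 3, and replaces
    psi t by psi (q^2 t); reindexing the sum brings out chi(q^2). *)
Lemma gauss_cubic_Frobenius q : prime q -> q != 3%N -> q \in [pchar F] -> q%:R != 0 :> k ->
    (forall t, psi (t * q%:R) = psi t ^+ q) ->
  w ^+ (cubic_log c q%:R + cubic_log c q%:R)%R * gauss w ^+ (q ^ 2) = gauss w.
Proof.
move=> q_pr q3 charF kq psiq.
have q2 : (q ^ 2 = 1 %[mod 3])%N by rewrite (sqr_mod3 q_pr q3) mulnC modnMDl.
have psiq2 t : psi t ^+ (q ^ 2) = psi (t * q%:R ^+ 2).
  by rewrite expnS expn1 exprM -!psiq mulrA.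
have -> : gauss w ^+ (q ^ 2) = \sum_t cubic_char c w t * psi (t * q%:R ^+ 2).
  rewrite expnS expn1 exprM -!(pFrobenius_autE charF) !rmorph_sum /=.
  apply: eq_bigr => t _.
  rewrite !(pFrobenius_autE charF) -exprM exprMn (_ : (q * q = q ^ 2)%N) // psiq2.
  congr (_ * _); rewrite /cubic_char; case: eqP => _.
    by rewrite expr0n expn_eq0 /= andbT; case: (q) q_pr.
  by rewrite exprAC -(expr_mod (q ^ 2) (cube_root1 w_root)) q2 expr1.
have q20 : q%:R ^+ 2 != 0 :> k by rewrite expf_neq0.
rewrite [RHS]/gauss_sum [RHS](reindex_inj (mulIf q20)) mulr_sumr.
apply: eq_bigr => t _; rewrite (cubic_charM c_root k3 w_root).
rewrite [cubic_char c w (_ ^+ 2)]/cubic_char (negPf q20) cubic_logM //.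
by rewrite mulrCA mulrA.
Qed.

End JacobiGauss.

Section Embed.
Variables (l : nat) (F : fieldType) (z : F).
Hypotheses (l_pr : prime l) (zl : z ^+ l = 1).

Lemma expr_FpD (s t : 'F_l) : z ^+ (s + t)%R = z ^+ s * z ^+ t.
Proof.
rewrite -exprD -(expr_mod (s + t)%N zl) /=; congr (z ^+ (_ %% _)).
exact: Fp_cast.
Qed.

Lemma expr_FpMn (s : 'F_l) n : z ^+ (s * n%:R)%R = (z ^+ s) ^+ n.
Proof.
by elim: n => [|n IHn]; rewrite ?mulr0 ?expr0 // mulrSr mulrDr mulr1 expr_FpD IHn exprSr.
Qed.

Lemma expr_Fp1 : z ^+ (1 : 'F_l)%R = z.
Proof. exact: expr1. Qed.

End Embed.

(** * Cubic reciprocity in the Eisenstein integers *)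

(** Pairs (a, b) of integers stand for the elements a + b w of Z[w]; evaluation at a cube
    root of unity of a ring is the reduction map, and evaluation at w^2 is evaluation of
    the conjugate. *)
Definition eis_eval (R : pzRingType) (w : R) (r : int * int) : R := r.1%:~R + r.2%:~R * w.
Definition eis_mul (r s : int * int) : int * int :=
  (r.1 * s.1 - r.2 * s.2, r.1 * s.2 + r.2 * s.1 - r.2 * s.2).
Definition eis_conj (r : int * int) : int * int := (r.1 - r.2, - r.2).
Definition eis_norm (r : int * int) : int := r.1 ^+ 2 - r.1 * r.2 + r.2 ^+ 2.

Section Eval.
Variables (R : comNzRingType) (w : R).
Hypothesis w_root : w ^+ 2 + w + 1 = 0.

Lemma eis_evalM r s : eis_eval w (eis_mul r s) = eis_eval w r * eis_eval w s.
Proof.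
case: r s => [a b] [x y]; rewrite /eis_eval /= !(rmorphB, rmorphD, rmorphM) /=.
apply/eqP; rewrite -subr_eq0 -(mulr0 (- (b%:~R * y%:~R))) -w_root; apply/eqP; ring.
Qed.

Lemma eis_eval_conj r : eis_eval w (eis_conj r) = eis_eval (w ^+ 2) r.
Proof.
case: r => [a b]; rewrite /eis_eval /= !(rmorphB, rmorphN) /=.
apply/eqP; rewrite -subr_eq0 -(mulr0 (- b%:~R)) -w_root; apply/eqP; ring.
Qed.

Lemma eis_eval_norm r : eis_eval w r * eis_eval (w ^+ 2) r = (eis_norm r)%:~R.
Proof.
rewrite -eis_eval_conj -eis_evalM /eis_eval /eis_norm /=; case: r => a b /=.
rewrite (_ : _ + _ - _ = 0) ?mul0r ?addr0; last by ring.
by congr (_ %:~R); ring.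
Qed.
End Eval.

Lemma eis_normM r s : eis_norm (eis_mul r s) = eis_norm r * eis_norm s.
Proof. by rewrite /eis_norm /=; ring. Qed.

Lemma eis_norm_conj r : eis_norm (eis_conj r) = eis_norm r.
Proof. by rewrite /eis_norm /=; ring. Qed.

(** The symbol of r = rho as a character chi of the rational integers prime to its norm.
    The third clause computes chi q from the image of (rho / conj rho)^((q^2 - 1)/3) in
    characteristic q: this is the square of the cubic residue symbol of rho at q.
    Dividing by the conjugate makes rational factors of rho invisible, treats q = 1 and
    q = 2 mod 3 alike, and gives an exponent independent of the choice of w.
    The second clause is the reciprocity law, chi n depends only on n modulo the norm; it
    is stated for opposite residues, -1 being a cube, because a norm of the shape m + n
    produces such congruences. *)
Definition cubic_symbol (r : int * int) (chi : nat -> 'Z_3) : Prop :=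
  let N := `|eis_norm r|%N in
  [/\ forall m n, coprime m N -> coprime n N -> chi (m * n)%N = chi m + chi n,
      forall m n, coprime m N -> (N %| m + n)%N -> chi m = chi n
    & forall q, prime q -> q != 3%N -> coprime q N ->
      forall (F : finFieldType) (w : F), q \in [pchar F] -> w ^+ 2 + w + 1 = 0 ->
      eis_eval w r ^+ ((q ^ 2).-1 %/ 3) =
        w ^+ chi q * eis_eval (w ^+ 2) r ^+ ((q ^ 2).-1 %/ 3)].

Lemma cubic_symbol_mul r s chi phi : cubic_symbol r chi -> cubic_symbol s phi ->
  cubic_symbol (eis_mul r s) (fun n => chi n + phi n).
Proof.
move=> [chiM chiC chiP] [phiM phiC phiP]; split; rewrite eis_normM abszM.
- move=> m n; rewrite !coprimeMr => /andP[mr ms] /andP[nr ns].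
  by rewrite chiM // phiM // addrACA.
- move=> m n; rewrite coprimeMr => /andP[mr ms] dv.
  rewrite (chiC m n mr (dvdn_trans (dvdn_mulr _ (dvdnn _)) dv)).
  by rewrite (phiC m n ms (dvdn_trans (dvdn_mull _ (dvdnn _)) dv)).
move=> q q_pr q3; rewrite coprimeMr => /andP[qr qs] F w charF w0.
rewrite !eis_evalM ?exprMn ?(chiP q _ _ _ F w) ?(phiP q _ _ _ F w) //;
  last exact: cube_root_sqr.
by rewrite exprZ3D //; ring.
Qed.

Lemma cubic_symbol_conj r chi : cubic_symbol r chi ->
  cubic_symbol (eis_conj r) (fun n => - chi n).
Proof.
move=> [chiM chiC chiP]; split; rewrite eis_norm_conj.
- by move=> m n mr nr; rewrite chiM // opprD.
- by move=> m n mr dv; rewrite (chiC m n).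
move=> q q_pr q3 qr F w charF w0.
rewrite eis_eval_conj // eis_eval_conj; last exact: cube_root_sqr.
rewrite (_ : (w ^+ 2) ^+ 2 = w) ?(chiP q _ _ _ F w) //.
  by rewrite mulrA -exprZ3D // addNr expr0 mul1r.
by rewrite -exprM exprS (cube_root1 w0) mulr1.
Qed.

Lemma cubic_symbol_rational (a : int) : cubic_symbol (a, 0) (fun=> 0).
Proof.
split=> //; first by move=> *; rewrite addr0.
by move=> *; rewrite /eis_eval /= !mul0r expr0 mul1r.
Qed.

Lemma eis_norm_ge0 r : 0 <= eis_norm r.
Proof. by case: r => a b; rewrite /eis_norm /=; nia. Qed.

Section JacobiSymbol.

Variables (l : nat) (c : 'F_l).
Hypotheses (l_pr : prime l) (l3 : l != 3%N) (c_root : c ^+ 2 + c + 1 = 0).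

Local Notation J := (jacobi_element c).

Lemma natrF_neq0 (F : fieldType) p n : p \in [pchar F] -> prime n -> p != n -> n%:R != 0 :> F.
Proof.
move=> charF n_pr neq; rewrite -(dvdn_pcharf charF) dvdn_prime2 //.
exact: pcharf_prime charF.
Qed.

Lemma Fp3_neq0 : 3%:R != 0 :> 'F_l.
Proof. exact: natrF_neq0 (pchar_Fp l_pr) _ l3. Qed.

Lemma eis_eval_jacobi (F : fieldType) (w : F) : w ^+ 2 + w + 1 = 0 ->
  eis_eval w J = jacobi_sum (cubic_char c w).
Proof. by move=> w0; rewrite (jacobi_sumE c_root Fp3_neq0). Qed.

Section Root.
Variables (F : fieldType) (z w : F).
Hypotheses (F3 : 3%:R != 0 :> F) (Fl : l%:R != 0 :> F).
Hypotheses (z_root : \sum_(i < l) z ^+ i = 0) (w_root : w ^+ 2 + w + 1 = 0).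

Let zl : z ^+ l = 1.
Proof. by apply/eqP; rewrite -subr_eq0 subrX1 z_root mulr0. Qed.

Let z1 : z != 1.
Proof.
apply: contraNneq Fl => z1; rewrite -z_root.
rewrite z1 (eq_bigr (fun=> 1)) => [|i _]; last by rewrite expr1n.
by rewrite sumr_const card_ord.
Qed.

Let psi (t : 'F_l) := z ^+ t.

Let psi_char : [/\ psi 0 = 1, psi 1 != 1 & forall s t, psi (s + t) = psi s * psi t].
Proof. by split; [rewrite /psi expr0 | rewrite /psi expr_Fp1 | exact: expr_FpD]. Qed.

Lemma eis_norm_jacobi_eval : (eis_norm J)%:~R = l%:R :> F.
Proof.
rewrite -(eis_eval_norm w_root) !eis_eval_jacobi //; last exact: cube_root_sqr.
have [psi0 psi1 psiD] := psi_char.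
by rewrite (@jacobi_cubicM _ _ c_root Fp3_neq0 F psi w) ?card_Fp.
Qed.

(** From g^3 = l J, the power g^(q^2 - 1) is (l J)^((q^2 - 1)/3), and Frobenius says
    that it is a cube root of unity determined by the cubic character of q modulo l.  The
    quotient by the conjugate relation eliminates l. *)
Lemma jacobi_reciprocity_eval q : prime q -> q != 3%N -> q != l -> q \in [pchar F] ->
  eis_eval w J ^+ ((q ^ 2).-1 %/ 3) =
    w ^+ (cubic_log c q%:R + cubic_log c q%:R)%R
      * eis_eval (w ^+ 2) J ^+ ((q ^ 2).-1 %/ 3).
Proof.
move=> q_pr q3 ql charF; set m := (_ %/ 3)%N; set kk := (_ + _)%R.
have w20 := cube_root_sqr w_root.
have [psi0 psi1 psiD] := psi_char.
have kF : #|'F_l|%:R != 0 :> F by rewrite card_Fp.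
have kq : q%:R != 0 :> 'F_l by apply: natrF_neq0 (pchar_Fp l_pr) _ _; rewrite 1?eq_sym.
have psiq t : psi (t * q%:R) = psi t ^+ q by rewrite /psi expr_FpMn.
have k3 := Fp3_neq0.
have q2 : (q ^ 2 = 3 * m + 1)%N := sqr_mod3 q_pr q3.
have pow (x : F) : x ^+ 2 + x + 1 = 0 -> gauss_sum psi (cubic_char c x) != 0 ->
    x ^+ kk * (l%:R ^+ m * eis_eval x J ^+ m) = 1.
  move=> x0 g0.
  have := @gauss_cubic_Frobenius _ _ c_root k3 F psi x x0 q q_pr q3 charF kq psiq.
  rewrite -/kk q2 exprD expr1 exprM (@gauss_cubic_cube _ _ c_root k3 F psi x) // card_Fp //.
  rewrite -eis_eval_jacobi // exprMn mulrA => /(canRL (mulfK g0)).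
  by rewrite divff.
have gg := @gauss_cubicM _ _ c_root k3 F psi w F3 psi0 psi1 psiD w_root.
have /andP[g1 g2] : (gauss_sum psi (cubic_char c w) != 0) &&
   (gauss_sum psi (cubic_char c (w ^+ 2)) != 0).
  by rewrite -negb_or -mulf_eq0 gg.
have e1 := pow w w_root g1; have e2 := pow _ w20 g2.
have lm0 : l%:R ^+ m != 0 :> F by rewrite expf_neq0.
have wk0 : w ^+ kk != 0.
  by apply: contraTneq (oner_neq0 F) => wk; rewrite -e1 wk mul0r eqxx.
apply: (mulfI lm0); apply: (mulfI wk0); rewrite e1; apply: etrans (esym e2) _; rewrite exprAC.
move: (w ^+ kk) (l%:R ^+ m) => x y.
by rewrite [x ^+ 2]expr2 -!mulrA; congr (x * _); rewrite mulrCA.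
Qed.

End Root.

(** The relation J(w) J(w^2) = l only makes sense in a field that contains the roots of
    unity; reading it in the algebraic numbers gives an identity of integers. *)
Lemma eis_norm_jacobi : eis_norm J = l.
Proof.
have [z prim_z] := C_prim_root_exists (prime_gt0 l_pr).
have [w prim_w] := C_prim_root_exists (isT : (0 < 3)%N).
apply/eqP; rewrite -(eqr_int algC); apply/eqP.
have sum0 n (x : algC) : (1 < n)%N -> n.-primitive_root x -> \sum_(i < n) x ^+ i = 0.
  move=> n1 prim_x; apply/eqP; have /eqP := prim_expr_order prim_x.
  rewrite -subr_eq0 subrX1 mulf_eq0 subr_eq0 => /orP[/eqP x1|//].
  have := eq_prim_root_expr prim_x 1 0; rewrite x1 !expr1n eqxx.
  by rewrite mod0n modn_small.
apply: (@eis_norm_jacobi_eval _ z w).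
- by rewrite pnatr_eq0.
- by rewrite pnatr_eq0 -lt0n prime_gt0.
- by rewrite sum0 ?prime_gt1.
by rewrite -(sum0 3%N w) // !big_ord_recl big_ord0 /= /bump /=; ring.
Qed.

Lemma jacobi_primary : (3 %| J.2)%Z.
Proof.
by apply: rpredB; apply: (jacobi_class_dvd3 c_root Fp3_neq0).
Qed.

Lemma cubic_symbol_jacobi : cubic_symbol J (fun n => cubic_log c n%:R + cubic_log c n%:R).
Proof.
have k3 := Fp3_neq0.
have nz n : coprime n l -> n%:R != 0 :> 'F_l.
  by rewrite coprime_sym prime_coprime // (dvdn_pcharf (pchar_Fp l_pr)).
split; rewrite eis_norm_jacobi /=.
- by move=> m n /nz m0 /nz n0; rewrite natrM (cubic_logM c_root) // addrACA.
- move=> m n /nz m0; rewrite (dvdn_pcharf (pchar_Fp l_pr)) natrD addr_eq0 => /eqP mn.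
  by move: m0; rewrite mn oppr_eq0 => n0; rewrite (cubic_logN c_root).
move=> q q_pr q3; rewrite prime_coprime // => ql F w charF w0.
have {}ql : q != l by apply: contraNneq ql => ->.
(* An l-th root of unity is adjoined to F to form Gauss sums; the relation descends. *)
pose P : {poly F} := \poly_(i < l) 1.
have szP : size P = l.
  by rewrite size_poly_eq ?oner_neq0.
have [|K [f [z rootz]]] := @finite_extension_root F P; first by rewrite szP prime_gt1.
have charK : q \in [pchar K] by rewrite (fmorph_pchar f).
have fw0 : f w ^+ 2 + f w + 1 = 0.
  by rewrite -rmorphXn -rmorphD -(rmorph1 f) -rmorphD w0 rmorph0.
have z0 : \sum_(i < l) z ^+ i = 0.
  move/rootP: rootz; rewrite horner_coef size_map_poly szP => eq0; rewrite -[RHS]eq0.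
  by apply: eq_bigr => i _; rewrite coef_map coef_poly ltn_ord /= rmorph1 mul1r.
have := @jacobi_reciprocity_eval K z (f w) _ _ z0 fw0 q q_pr q3 ql charK.
have fE (x : F) : eis_eval (f x) J = f (eis_eval x J).
  by case: (J) => a b; rewrite /eis_eval [RHS]rmorphD [in RHS]rmorphM /= !rmorph_int.
rewrite -[f w ^+ 2]rmorphXn !fE -!rmorphXn -rmorphM => eqf.
apply: (fmorph_inj f); apply: eqf; exact: natrF_neq0 charK _ _.
Qed.

End JacobiSymbol.

Lemma dvdz_Fp l (x : int) : prime l -> (l%:Z %| x)%Z = (x%:~R == 0 :> 'F_l).
Proof. by move=> l_pr; rewrite (dvdz_pcharf (pchar_Fp l_pr)). Qed.

Lemma dvdz_primeM l (x y : int) : prime l ->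
  (l%:Z %| x * y)%Z = (l%:Z %| x)%Z || (l%:Z %| y)%Z.
Proof. by move=> l_pr; rewrite !dvdz_Fp // rmorphM /= mulf_eq0. Qed.

Lemma eis_scale_norm (l : int) r : eis_norm (l * r.1, l * r.2) = l ^+ 2 * eis_norm r.
Proof. by rewrite /eis_norm /=; ring. Qed.

Lemma cubic_symbol_scale (l : int) r chi :
  cubic_symbol r chi -> cubic_symbol (l * r.1, l * r.2) chi.
Proof.
move=> rP; have := cubic_symbol_mul (cubic_symbol_rational l) rP.
rewrite (_ : eis_mul _ _ = (l * r.1, l * r.2)) => [[cM cC cP]|]; last first.
  by rewrite /eis_mul /=; congr (_, _); ring.
split.
- by move=> m n mN nN; have := cM m n mN nN; rewrite !add0r.
- by move=> m n mN dv; have := cC m n mN dv; rewrite !add0r.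
by move=> q q_pr q3 qN F w cF w0; have := cP q q_pr q3 qN F w cF w0; rewrite !add0r.
Qed.

(** A prime l dividing the norm but not rho has a cube root of unity c modulo l at which
    rho vanishes.  The Jacobi sum attached to c, or its conjugate, vanishes at c too, and
    having norm l it divides rho. *)
Lemma prime_eis_factor (l : nat) (r : int * int) : prime l -> l != 3%N ->
    (l%:Z %| eis_norm r)%Z -> ~~ (l%:Z %| r.2)%Z ->
  exists s, [/\ eis_norm s = l, (3 %| s.2)%Z, exists chi, cubic_symbol s chi
              & exists r', r = eis_mul r' s].
Proof.
move=> l_pr l3 lN lr2; case: r => a b /= in lN lr2 *.
have b0 : b%:~R != 0 :> 'F_l by rewrite -dvdz_Fp.
pose c : 'F_l := - a%:~R / b%:~R.
have rc : eis_eval c (a, b) = 0 by rewrite /eis_eval /= /c; field.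
have c_root : c ^+ 2 + c + 1 = 0.
  have N0 : a%:~R ^+ 2 - a%:~R * b%:~R + b%:~R ^+ 2 = 0 :> 'F_l.
    move: lN; rewrite dvdz_Fp // /eis_norm /=.
    by rewrite !(rmorphD, rmorphN, rmorphM, rmorphXn) => /eqP.
  have -> : c ^+ 2 + c + 1 = (a%:~R ^+ 2 - a%:~R * b%:~R + b%:~R ^+ 2) / b%:~R ^+ 2.
    by rewrite /c; field.
  by rewrite N0 mul0r.
have k3 := Fp3_neq0 l_pr l3; have c1 := cube_root_neq1 k3 c_root.
have [s [sN s3 sP sc]] : exists s, [/\ eis_norm s = l, (3 %| s.2)%Z,
    exists chi, cubic_symbol s chi & eis_eval c s = 0].
  have JN := eis_norm_jacobi l_pr l3 c_root.
  have JP := cubic_symbol_jacobi l_pr l3 c_root.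
  have J3 := jacobi_primary l_pr l3 c_root.
  move/(congr1 (fun x : int => x%:~R : 'F_l)): (JN).
  rewrite -(eis_eval_norm c_root) -pmulrn (pcharf0 (pchar_Fp l_pr)) => /eqP.
  rewrite mulf_eq0 => /orP[] /eqP Jc.
    by exists (jacobi_element c); split=> //; eexists; exact: JP.
  exists (eis_conj (jacobi_element c)); split; first by rewrite eis_norm_conj.
  - by rewrite /= rpredN.
  - by eexists; apply: cubic_symbol_conj JP.
  by rewrite eis_eval_conj.
exists s; split=> //.
(* t = rho conj(s) vanishes at c and at c^2, hence is divisible by l; then rho = (t/l) s. *)
pose t := eis_mul (a, b) (eis_conj s).
have t1 : eis_eval c t = 0 by rewrite eis_evalM // rc mul0r.
have t2 : eis_eval (c ^+ 2) t = 0.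
  have c2 := cube_root_sqr c_root.
  rewrite eis_evalM // eis_eval_conj // (_ : (c ^+ 2) ^+ 2 = c) ?sc ?mulr0 //.
  by rewrite -exprM exprS (cube_root1 c_root) mulr1.
have ty : t.2%:~R = 0 :> 'F_l.
  have /eqP : t.2%:~R * (c * (c - 1)) = eis_eval (c ^+ 2) t - eis_eval c t.
    by rewrite /eis_eval; ring.
  rewrite t1 t2 subrr mulf_eq0 mulf_eq0 subr_eq0 (negPf c1) orbF => /orP[/eqP//|c0].
  by move: (cube_root1 c_root); rewrite (eqP c0) expr0n => /eqP; rewrite eq_sym oner_eq0.
have tx : t.1%:~R = 0 :> 'F_l by move: t1; rewrite /eis_eval ty mul0r addr0.
have /dvdzP[x xE] : (l%:Z %| t.1)%Z by rewrite dvdz_Fp ?tx.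
have /dvdzP[y yE] : (l%:Z %| t.2)%Z by rewrite dvdz_Fp ?ty.
have l0 : l%:Z != 0 by rewrite -lt0n prime_gt0.
exists (x, y); rewrite /eis_mul /=.
have eN : s.1 ^+ 2 - s.1 * s.2 + s.2 ^+ 2 = l by rewrite -sN.
congr (_, _); apply: (mulIf l0).
  have -> : (x * s.1 - y * s.2) * l%:Z = (x * l) * s.1 - (y * l) * s.2 by ring.
  by rewrite -xE -yE -eN /t /=; ring.
have -> : (x * s.2 + y * s.1 - y * s.2) * l%:Z =
  (x * l) * s.2 + (y * l) * s.1 - (y * l) * s.2 by ring.
by rewrite -xE -yE -eN /t /=; ring.
Qed.

(** Descent on the norm.  The condition 3 | r.2 says that rho is congruent to a rational
    integer modulo 3; among the elements of norm 1 it leaves only 1 and -1, and it is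
    inherited by the cofactor when a rational prime or a Jacobi sum is divided out. *)
Lemma cubic_reciprocity (r : int * int) : (3 %| r.2)%Z -> ~~ (3 %| eis_norm r)%Z ->
  exists chi, cubic_symbol r chi.
Proof.
elim: {r}`|eis_norm r|.+1%N {-2}r (ltnSn `|eis_norm r|) => // n IHn r.
rewrite ltnS => leN r3 N3; have N_ge0 := eis_norm_ge0 r.
have [|N_gt1] := leqP `|eis_norm r|%N 1.
  case: r N_ge0 N3 r3 {leN} => a b /=; rewrite /eis_norm /= => N0 N3 /dvdzP[b' ->] N1.
  (* In norm 1, 4 = (2a - b)^2 + 3b^2 with b divisible by 3 forces b = 0. *)
  have b0 : b' = 0 by nia.
  by exists (fun=> 0); rewrite b0 mul0r; apply: cubic_symbol_rational.
pose l := pdiv `|eis_norm r|%N; have l_pr : prime l by rewrite pdiv_prime.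
have lN : (l%:Z %| eis_norm r)%Z by rewrite dvdzE pdiv_dvd.
have l3 : l != 3%N by apply: contraNneq N3 => l3; move: lN; rewrite l3.
have l_gt1 := prime_gt1 l_pr.
have l3' : ~~ (3%N%:Z %| l%:Z)%Z by rewrite dvdzE dvdn_prime2 // eq_sym.
have [lr2|lr2] := boolP (l%:Z %| r.2)%Z.
  have lr1 : (l%:Z %| r.1)%Z.
    move: lN lr2; rewrite !dvdz_Fp // /eis_norm !(rmorphD, rmorphN, rmorphM, rmorphXn) /=.
    move=> e /eqP r2; move: e; rewrite r2 mulr0 expr0n subr0 addr0.
    by rewrite expf_eq0.
  case/dvdzP: lr1 => a aE; case/dvdzP: lr2 => b bE.
  have rE : r = (l%:Z * a, l%:Z * b) by rewrite [r]surjective_pairing aE bE !(mulrC l%:Z).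
  have NE : eis_norm r = l%:Z ^+ 2 * eis_norm (a, b) by rewrite rE (eis_scale_norm l (a, b)).
  have [|||chi chiP] := IHn (a, b).
  - by apply: leq_trans leN; have := eis_norm_ge0 (a, b); nia.
  - by move: r3; rewrite rE (dvdz_primeM _ _ (isT : prime 3)) (negPf l3').
  - by apply: contraNN N3 => N3; rewrite NE dvdz_mull.
  by exists chi; rewrite rE; apply: (cubic_symbol_scale l chiP).
have [s [sN s3 [chi chiP] [r' rE]]] := prime_eis_factor l_pr l3 lN lr2.
have N' : eis_norm r = eis_norm r' * l by rewrite rE eis_normM sN.
have [|||phi phiP] := IHn r'.
- apply: leq_trans leN; rewrite N' abszM; have := eis_norm_ge0 r'.
  have : eis_norm r' != 0 by apply: contraTneq N_gt1 => N0; rewrite N' N0 mul0r.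
  nia.
- have s31 : ~~ (3%N%:Z %| s.1)%Z.
    apply: contraNN N3 => s31; rewrite N' dvdz_mull // -sN /eis_norm.
    by rewrite !expr2 rpredD ?rpredB // ?dvdz_mull.
  have : (3 %| r'.2 * s.1)%Z.
    have -> : r'.2 * s.1 = r.2 - r'.1 * s.2 + r'.2 * s.2 by rewrite rE /=; ring.
    by rewrite rpredD ?rpredB // ?dvdz_mull.
  by rewrite (dvdz_primeM _ _ (isT : prime 3)) (negPf s31) orbF.
- by apply: contraNN N3 => N3; rewrite N' dvdz_mulr.
by eexists; rewrite rE; apply: cubic_symbol_mul phiP chiP.
Qed.

(** * Norms from the field of discriminant -11 *)

(** Writing the form A X^2 + B X Y + C Y^2 as the norm of (X alpha + Y beta)/2 with alpha
    and beta in Z[sqrt(-11)] is a property that passes through reduction steps in both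
    directions, which a mere representation of A would not do.  The reduced form is
    X^2 + X Y + 3 Y^2 up to the sign of X Y. *)
Lemma form_disc_m11 (A B C : int) : 0 < A -> B ^+ 2 + 11 = 4 * A * C ->
  exists x y z t : int,
    [/\ x ^+ 2 + 11 * y ^+ 2 = 4 * A, z ^+ 2 + 11 * t ^+ 2 = 4 * C
      & x * z + 11 * y * t = 2 * B].
Proof.
elim: {A}`|A|.+1%N {-2}A (ltnSn `|A|) B C => // n IHn A leA B C A0 disc.
have [k [leB1 leB2]] : exists k, - A <= B + 2 * k * A /\ B + 2 * k * A <= A.
  (* Translate B into the interval from -A to A modulo 2A. *)
  exists (- ((B + A) %/ (2 * A))%Z).
  have := divz_eq (B + A) (2 * A); have := modz_ge0 (B + A) (_ : 2 * A != 0).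
  have := ltz_pmod (B + A) (_ : 0 < 2 * A).
  move: (_ %% _)%Z (_ %/ _)%Z => r q h1 h2 e.
  have {}h1 : r < 2 * A by apply: h1; lia.
  have {}h2 : 0 <= r by apply: h2; lia.
  split; nia.
pose B' := B + 2 * k * A; pose C' := C + k * B + k ^+ 2 * A.
have disc' : B' ^+ 2 + 11 = 4 * A * C' by rewrite /B' /C'; nia.
suffices [x [y [z [t [e1 e2 e3]]]]] : exists x y z t : int,
    [/\ x ^+ 2 + 11 * y ^+ 2 = 4 * A, z ^+ 2 + 11 * t ^+ 2 = 4 * C'
      & x * z + 11 * y * t = 2 * B'].
  exists x, y, (z - k * x), (t - k * y); split=> //.
    have -> : (z - k * x) ^+ 2 + 11 * (t - k * y) ^+ 2 = (z ^+ 2 + 11 * t ^+ 2)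
      - 2 * k * (x * z + 11 * y * t) + k ^+ 2 * (x ^+ 2 + 11 * y ^+ 2) by ring.
    by rewrite e1 e2 e3 /B' /C'; ring.
  have -> : x * (z - k * x) + 11 * y * (t - k * y) = (x * z + 11 * y * t)
      - k * (x ^+ 2 + 11 * y ^+ 2) by ring.
  by rewrite e1 e3 /B'; ring.
rewrite -/B' in leB1 leB2; move: B' C' leB1 leB2 disc' => {}B {}C leB1 leB2 {}disc {k}.
have [leAC|ltCA] := lerP A C.
  have A1 : A = 1 by nia.
  rewrite {}A1 in leB1 leB2 disc *.
  have [B1 C3] : (B = 1 \/ B = -1) /\ C = 3.
    have : (B = 0 \/ B = 1 \/ B = -1) by lia.
    by move=> [|[]] e; rewrite e in disc *; lia.
  by case: B1 => ->; [exists 2, 0, 1, 1 | exists 2, 0, (-1), 1]; rewrite C3.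
have [|||z [t [x [y [e1 e2 e3]]]]] := IHn C _ B A; [nia|nia|lia|].
by exists x, y, z, t; split=> //; lia.
Qed.

Lemma norm4_of_sqrt_m11 (p s : int) : 0 < p -> odd `|p| -> (p %| s ^+ 2 + 11)%Z ->
  exists a b : int, a ^+ 2 + 11 * b ^+ 2 = 4 * p.
Proof.
move=> p0 p_odd.
wlog s_odd : s / odd `|s|.
  move=> IH ps; have [s_odd|s_even] := boolP (odd `|s|); first exact: IH ps.
  (* Make s odd, so that s^2 + 11 is also divisible by 4. *)
  apply: (IH (s + p)); first by lia.
  have -> : (s + p) ^+ 2 + 11 = s ^+ 2 + 11 + p * (2 * s + p) by ring.
  by rewrite rpredD // dvdz_mulr.
move=> /dvdzP[D sD].
have [s' ss'] : exists s', s = 2 * s' + 1 by exists (s %/ 2)%Z; lia.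
have e : 4 * (s' ^+ 2 + s' + 3) = D * p by rewrite -sD ss'; ring.
have /dvdzP[D4 DD] : (4 %| D)%Z.
  rewrite -(@Gauss_dvdzl 4 D p); first by rewrite -e dvdz_mulr.
  by rewrite coprimezE -[`|4|%N]/(2 ^ 2)%N coprime_pexpl // coprime2n.
have disc : s ^+ 2 + 11 = 4 * p * D4 by rewrite sD DD; ring.
by have [x [y [_ [_ [eN _ _]]]]] := form_disc_m11 p0 disc; exists x, y.
Qed.

Lemma int_half (c : int) : exists q, c = 2 * q \/ c = 2 * q + 1.
Proof. by exists (c %/ 2)%Z; lia. Qed.

Lemma norm4_parity (n a b : int) :
  a ^+ 2 + 11 * b ^+ 2 = 4 * n -> odd `|a| = odd `|b|.
Proof.
have [qa qaE] := int_half a; have [qb qbE] := int_half b.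
by case: qaE => ->; case: qbE => ->; lia.
Qed.

Lemma norm48_solutions (j k : int) : j ^+ 2 + 11 * k ^+ 2 = 48 ->
  (j = 2 \/ j = -2) /\ (k = 2 \/ k = -2).
Proof.
move=> jk.
have kB : k ^+ 2 <= 4 by have := sqr_ge0 j; lia.
have jB : j ^+ 2 <= 48 by have := sqr_ge0 k; lia.
have {}kB : k = 0 \/ k = 1 \/ k = -1 \/ k = 2 \/ k = -2.
  have : - 2 <= k by apply: contraLR kB; rewrite -!ltNge; nia.
  have : k <= 2 by apply: contraLR kB; rewrite -!ltNge; nia.
  lia.
have {}jB : - 6 <= j <= 6.
  by apply/andP; split; apply: contraLR jB; rewrite -!ltNge; nia.
have {}kB : k = 2 \/ k = -2.
  by move: kB => [|[|[|[|]]]] e; rewrite e in jk; [nia|nia|nia|left|right].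
have {}jB : j = 2 \/ j = -2.
  have j4 : (j - 2) * (j + 2) = 0 by case: kB jk => ->; lia.
  by move/eqP: j4; rewrite mulf_eq0 => /orP[]/eqP; lia.
by [].
Qed.

(** Unique factorization in disguise: p divides (ub - va)(ub + va), and the vanishing of
    one factor modulo p expresses u + v sqrt(-11) as a multiple of a + b sqrt(-11), or
    of its conjugate, by an element of norm 3. *)
Lemma norm12_solutions (p : nat) (a b u v : int) : prime p ->
    a ^+ 2 + 11 * b ^+ 2 = 4 * p%:Z -> u ^+ 2 + 11 * v ^+ 2 = 12 * p%:Z ->
  (2 * `|u| = `|a - 11 * b| /\ 2 * `|v| = `|a + b|) \/
  (2 * `|u| = `|a + 11 * b| /\ 2 * `|v| = `|a - b|).
Proof.
move=> p_pr eab euv.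
have p0 : p%:Z <> 0 by have := prime_gt0 p_pr; lia.
have main (v' : int) : `|v'| = `|v| -> v' ^+ 2 = v ^+ 2 -> (p%:Z %| u * b - v' * a)%Z ->
  (2 * `|u| = `|a - 11 * b| /\ 2 * `|v| = `|a + b|) \/
  (2 * `|u| = `|a + 11 * b| /\ 2 * `|v| = `|a - b|).
  move=> vv vv2 /dvdzP[k kE]; rewrite -vv2 in euv; rewrite -vv.
  move: v' {vv vv2} euv kE => {}v euv kE.
  (* The product of the norms is 48 p^2, so both ub - va = pk and ua + 11vb = pj, with
     j^2 + 11k^2 = 48. *)
  have wE : (u * a + 11 * v * b) ^+ 2 = p%:Z * (p%:Z * (48 - 11 * k ^+ 2)).
    have -> : (u * a + 11 * v * b) ^+ 2 = (u ^+ 2 + 11 * v ^+ 2) * (a ^+ 2 + 11 * b ^+ 2)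
        - 11 * (u * b - v * a) ^+ 2 by ring.
    by rewrite euv eab kE; ring.
  have /dvdzP[j jE] : (p%:Z %| u * a + 11 * v * b)%Z.
    have : (p%:Z %| (u * a + 11 * v * b) ^+ 2)%Z by rewrite wE dvdz_mulr.
    by rewrite !dvdzE abszX Euclid_dvdX // andbT.
  have jk : j ^+ 2 + 11 * k ^+ 2 = 48.
    apply: (mulfI (introN eqP p0)); apply: (mulfI (introN eqP p0)).
    by move: wE; rewrite jE; lia.
  have uE : 4 * u = a * j + 11 * b * k.
    apply: (mulIf (introN eqP p0)).
    have -> : 4 * u * p%:Z = u * (4 * p%:Z) by ring.
    have -> : (a * j + 11 * b * k) * p%:Z = a * (j * p%:Z) + 11 * b * (k * p%:Z) by ring.
    by rewrite -eab -jE -kE; ring.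
  have vE : 4 * v = b * j - a * k.
    apply: (mulIf (introN eqP p0)).
    have -> : 4 * v * p%:Z = v * (4 * p%:Z) by ring.
    have -> : (b * j - a * k) * p%:Z = b * (j * p%:Z) - a * (k * p%:Z) by ring.
    by rewrite -eab -jE -kE; ring.
  have [jB kB] := norm48_solutions jk.
  clear -jB kB uE vE; case: jB kB uE vE => -> [] -> uE vE; lia.
have : (p%:Z %| (u * b - v * a) * (u * b - (- v) * a))%Z.
  have -> : (u * b - v * a) * (u * b - (- v) * a) =
    (u ^+ 2 + 11 * v ^+ 2) * b ^+ 2 - (a ^+ 2 + 11 * b ^+ 2) * v ^+ 2 by ring.
  by rewrite euv eab rpredB // -mulrA mulrCA dvdz_mulr.
rewrite dvdzE abszM Euclid_dvdM // => /orP[] dv.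
  exact: (main v).
by apply: (main (- v)); rewrite ?normrN ?sqrrN.
Qed.

(** * Parity of the coefficients: the pentagonal number theorem modulo 2 *)

Definition triangular (s : nat) : nat := 'C(s.+1, 2).

Lemma triangular0 : triangular 0 = 0%N. Proof. exact: bin_small. Qed.

Section Pentagonal.
Variables (R : comNzRingType) (x : R).

(** Shanks's finite form of Euler's pentagonal series: the term s = 0 is the product of
    the 1 - x^k for k <= n, the other terms are divisible by x^(n+1), and the sum gains
    just two monomials when n grows by 1. *)
Definition shanks_sum n :=
  \sum_(0 <= s < n.+1)
    (-1) ^+ s * (\prod_(s.+1 <= k < n.+1) (1 - x ^+ k)) * x ^+ (s * n + triangular s).

Lemma triangularS s : triangular s.+1 = (triangular s + s.+1)%N.
Proof. by rewrite /triangular binS bin1. Qed.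

Lemma triangular2 n : (2 * triangular n = n * n.+1)%N.
Proof. by elim: n => [|n IHn]; [rewrite triangular0 | rewrite triangularS; lia]. Qed.

(** Split 1 - x^(n+1) in each term, and write x^s = 1 - (1 - x^s) in the part that
    carries x^(s(n+1)).  The corrections D and B satisfy D (s+1) = - B s, so that they
    cancel except for the last B. *)
Lemma shanks_sumS n :
  shanks_sum n.+1 = shanks_sum n +
    (-1) ^+ n.+1 * (x ^+ (n.+1 ^ 2 + triangular n) + x ^+ (n.+1 ^ 2 + triangular n.+1)).
Proof.
pose Q s := \prod_(s.+1 <= k < n.+1) (1 - x ^+ k).
pose B s := (-1) ^+ s * Q s * x ^+ (s.+1 * n.+1 + triangular s).
pose D s := (-1) ^+ s * Q s * (1 - x ^+ s) * x ^+ (s * n + triangular s).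
have QS s : (s <= n)%N -> \prod_(s.+1 <= k < n.+2) (1 - x ^+ k) = Q s * (1 - x ^+ n.+1).
  by move=> ?; rewrite big_nat_recr.
have -> : shanks_sum n.+1 = shanks_sum n - \sum_(0 <= s < n.+1) D s
    - \sum_(0 <= s < n.+1) B s + (-1) ^+ n.+1 * x ^+ (n.+1 ^ 2 + triangular n.+1).
  rewrite {1}/shanks_sum big_nat_recr //=; congr (_ + _).
    rewrite -!sumrB; apply: eq_big_nat => s /andP[_ ltsn].
    rewrite QS // /B /D -/(Q s) mulnS mulSn -!addnA [(s + (s * n + _))%N]addnC exprD.
    rewrite (_ : n.+1 + (s * n.+1 + _) = n.+1 + (s * n + triangular s) + s)%N; last by lia.
    by rewrite !exprD; ring.
  by rewrite big_geq // mulr1 mulnn.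
have -> : \sum_(0 <= s < n.+1) D s = - \sum_(0 <= s < n) B s.
  rewrite big_nat_recl // {1}/D expr0 subrr mulr0 mul0r add0r -sumrN.
  apply: eq_big_nat => s /andP[_ ltsn]; rewrite /D /B exprS.
  have -> : Q s = (1 - x ^+ s.+1) * Q s.+1 by rewrite /Q big_ltn.
  rewrite triangularS (_ : s.+1 * n + _ = s.+1 * n.+1 + triangular s)%N; last by lia.
  ring.
rewrite [\sum_(0 <= s < n.+1) B s]big_nat_recr //=.
have -> : B n = (-1) ^+ n * x ^+ (n.+1 ^ 2 + triangular n).
  by rewrite /B /Q big_geq // mulr1 mulnn.
rewrite exprS; ring.
Qed.

Lemma shanks_sum_tail n : exists y,
  \prod_(1 <= k < n.+1) (1 - x ^+ k) = shanks_sum n + x ^+ n.+1 * y.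
Proof.
pose y s := (-1) ^+ s.+1 * (\prod_(s.+2 <= k < n.+1) (1 - x ^+ k))
  * x ^+ (s * n + triangular s + s).
exists (- \sum_(0 <= s < n) y s).
rewrite /shanks_sum [in RHS]big_nat_recl // expr0 mul1r mul0n triangular0 expr0 mulr1.
rewrite mulrN mulr_sumr -addrA -sumrB.
rewrite [X in _ + X]big_nat_cond [X in _ + X]big1 ?addr0 // => s /andP[/andP[_ ltsn] _].
rewrite -/(triangular _) triangularS /y.
rewrite (_ : s.+1 * n + _ = n.+1 + (s * n + triangular s + s))%N; last by lia.
by rewrite exprD; ring.
Qed.

Hypothesis R2 : 2%:R = 0 :> R.

(** The exponents m^2 + T(m-1) and m^2 + T(m), with T the triangular numbers, are
    ((6m-1)^2 - 1)/24 and ((6m+1)^2 - 1)/24, and the numbers 6m-1 and 6m+1 are the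
    positive integers prime to 6.  Signs disappear in characteristic 2. *)
Lemma shanks_sum_char2 n :
  shanks_sum n = \sum_(0 <= u < 6 * n + 2 | coprime u 6) x ^+ ((u ^ 2).-1 %/ 24).
Proof.
have RN (y : R) : - y = y.
  by apply/eqP; rewrite eq_sym -subr_eq0 opprK -mulr2n -mulr_natl R2 mul0r.
elim: n => [|n IHn].
  rewrite /shanks_sum big_nat1 big_geq // expr0 mulr1 mul1r triangular0 expr0.
  by rewrite big_mkcond /= 2?big_nat_recr //= big_geq // !add0r /= expr0.
rewrite shanks_sumS IHn RN expr1n mul1r (_ : 6 * n.+1 + 2 = (6 * n + 2).+4.+2)%N; last by lia.
have cop i : coprime (6 * n + i) 6 = coprime i 6.
  by rewrite -(coprime_modl (6 * n + i)) mulnC modnMDl coprime_modl.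
rewrite [RHS]big_mkcond 6?big_nat_recr ?leq0n //= -big_mkcond /= -!addnS !cop /=.
rewrite !addr0 -addrA; congr (_ + (x ^+ _ + x ^+ _)).
  by rewrite expn1 -mulnn; have := triangular2 n; clear; lia.
by rewrite expn1 -mulnn; have := triangular2 n.+1; clear; lia.
Qed.
End Pentagonal.

Lemma pchar2_poly_F2 : 2%:R = 0 :> {poly 'F_2}.
Proof. by rewrite -polyC_natr (pcharf0 (pchar_Fp (isT : prime 2))). Qed.

Lemma map_newform11_trunc N : map_poly (intr : int -> 'F_2) (newform11_trunc N) =
  'X * (\prod_(1 <= k < N.+1) (1 - ('X^2) ^+ k)) * \prod_(1 <= k < N.+1) (1 - ('X^22) ^+ k).
Proof.
rewrite /newform11_trunc rmorphM /= map_polyX -mulrA rmorph_prod -big_split /=; congr (_ * _).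
have sqr (y : {poly 'F_2}) : (1 - y) ^+ 2 = 1 - y ^+ 2.
  have -> : (1 - y) ^+ 2 = 1 - y ^+ 2 + 2%:R * (y ^+ 2 - y) by ring.
  by rewrite pchar2_poly_F2 mul0r addr0.
apply: eq_bigr => k _; rewrite rmorphM !rmorphXn !rmorphB !rmorph1 /= !map_polyXn !sqr.
by rewrite -!exprM mulnC -mulnA [(k * 2)%N]mulnC mulnA.
Qed.

(** Both coordinates of a solution of u^2 + 11 v^2 = 12N are less than 6N + 2, a bound
    that the truncated pentagonal series imposes. *)
Definition norm12_pairs (N : nat) :=
  let M := (6 * N + 2)%N in
  [set w : 'I_M * 'I_M | [&& coprime w.1 6, coprime w.2 6
                           & w.1 ^ 2 + 11 * w.2 ^ 2 == 12 * N]%N].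

Lemma coprime6_sqr u : coprime u 6 -> (u ^ 2 = 24 * ((u ^ 2).-1 %/ 24) + 1)%N.
Proof.
have : (u = 6 * (u %/ 6) + u %% 6)%N by lia.
rewrite -coprime_modl; have := ltn_pmod u (isT : (0 < 6)%N).
move: (u %/ 6)%N (u %% 6)%N => q [|[|[|[|[|[|//]]]]]] // _ -> _.
  have [r qE] : exists r, q = (2 * r)%N \/ q = (2 * r + 1)%N by exists q./2; lia.
  by case: qE => ->; rewrite -mulnn; lia.
have [r qE] : exists r, q = (2 * r)%N \/ q = (2 * r + 1)%N by exists q./2; lia.
by case: qE => ->; rewrite -mulnn; lia.
Qed.

(** Modulo 2, (1 - x)^2 = 1 - x^2 turns the eta product into q P(q^2) P(q^22) with P
    Euler's product.  By the pentagonal number theorem its monomials have exponents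
    1 + 2(u^2 - 1)/24 + 22(v^2 - 1)/24 = (u^2 + 11 v^2)/12. *)
Lemma newform11_coef_mod2 N :
  (newform11_coef N)%:~R = #|norm12_pairs N|%:R :> 'F_2.
Proof.
pose M := (6 * N + 2)%N; pose e u := ((u ^ 2).-1 %/ 24)%N.
have [y2 e2] := shanks_sum_tail ('X^2 : {poly 'F_2}) N.
have [y22 e22] := shanks_sum_tail ('X^22 : {poly 'F_2}) N.
rewrite /newform11_coef -coef_map /= map_newform11_trunc e2 e22.
rewrite !(shanks_sum_char2 _ pchar2_poly_F2) -/M.
set A := \sum_(_ <= _ < _ | _) _; set B := \sum_(_ <= _ < _ | _) _.
have -> : 'X * (A + 'X^2 ^+ N.+1 * y2) * (B + 'X^22 ^+ N.+1 * y22) =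
   'X * (A * B) + ('X^(N.+1) * y2 * B
      + 'X^(21 * N + 21) * (A + 'X^2 ^+ N.+1 * y2) * y22) * 'X^(N.+2).
  have -> : 'X^2 ^+ N.+1 = 'X^(N.+1) * 'X^(N.+1) :> {poly 'F_2}.
    by rewrite -exprM mul2n -addnn exprD.
  have -> : 'X^22 ^+ N.+1 = 'X^(21 * N + 21) * 'X^(N.+1) :> {poly 'F_2}.
    by rewrite -exprM -exprD; congr ('X^_); lia.
  rewrite ['X^(N.+2)]exprS; move: ('X^(N.+1)) ('X^(21 * N + 21)) => P Q; ring.
rewrite coefD coefMXn ltnS leqnSn addr0 /A /B big_distrlr /= mulr_sumr !big_mkord coef_sum.
have -> : #|norm12_pairs N|%:R =
    \sum_u \sum_v (if (u, v) \in norm12_pairs N then 1 else 0) :> 'F_2.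
  rewrite pair_bigA /= -sum1_card natr_sum big_mkcond.
  by apply: eq_bigr => -[u v] _.
rewrite big_mkcond /=.
apply: eq_bigr => u _; case: ifP => cu; last first.
  by rewrite big1 // => v _; rewrite inE /= cu.
rewrite mulr_sumr coef_sum big_mkcond big_mkord /=; apply: eq_bigr => v _.
rewrite inE /= cu /=; case: ifP => // cv.
rewrite -!exprM -exprD -exprS coefXn (_ : (N == _) = (u ^ 2 + 11 * v ^ 2 == 12 * N)%N).
  by case: eqP.
by have := coprime6_sqr cu; have := coprime6_sqr cv; rewrite -!/(e _); lia.
Qed.

(** If 3 divides u it divides v, so 9 divides 12p and p = 3; the only solution of
    u^2 + 11 v^2 = 36 with u and v divisible by 3 has v = 0. *)
Lemma norm12_coprime6 (p u v : nat) : prime p -> odd u -> odd v ->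
  (u ^ 2 + 11 * v ^ 2 = 12 * p)%N -> coprime u 6 && coprime v 6.
Proof.
move=> p_pr ou ov; rewrite -!mulnn => e.
have cop (n : nat) : odd n -> ~~ (3 %| n)%N -> coprime n 6.
  by move=> on n3; rewrite -[6%N]/(2 * 3)%N coprimeMr coprimen2 on coprime_sym prime_coprime.
have e3 : (3 %| u * u + 11 * (v * v))%N by rewrite e dvdn_mulr.
have uv3 : (3 %| u)%N = (3 %| v)%N.
  have -> : (3 %| u)%N = (3 %| u * u)%N by rewrite Euclid_dvdM // orbb.
  have -> : (3 %| v)%N = (3 %| 11 * (v * v))%N by rewrite !Euclid_dvdM //= orbb.
  apply/idP/idP => d3; first by rewrite -(dvdn_addr _ d3).
  by rewrite -(dvdn_addl _ d3).
have [u3|u3] := boolP (3 %| u)%N; last by rewrite !cop // -uv3.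
have v3 : (3 %| v)%N by rewrite -uv3.
case/dvdnP: u3 => u' u'E; case/dvdnP: v3 => v' v'E; rewrite u'E v'E in e ou ov.
have p3 : p = 3%N.
  have : (3 %| 4 * p)%N by apply/dvdnP; exists (u' * u' + 11 * (v' * v'))%N; lia.
  by rewrite Euclid_dvdM //= dvdn_prime2 // => /eqP.
rewrite p3 in e; have : v' = 0%N by nia.
by move=> v0; rewrite v0 in ov.
Qed.

Lemma mem_norm12_pairs (p u v : nat) : prime p -> odd u -> odd v ->
    (u ^ 2 + 11 * v ^ 2 = 12 * p)%N ->
  exists2 w, w \in norm12_pairs p & (w.1 = u :> nat) /\ (w.2 = v :> nat).
Proof.
move=> p_pr ou ov e; have p0 := prime_gt0 p_pr.
have lu : (u < 6 * p + 2)%N by move: e; rewrite -!mulnn; nia.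
have lv : (v < 6 * p + 2)%N by move: e; rewrite -!mulnn; nia.
exists (Ordinal lu, Ordinal lv) => //=.
by rewrite inE /= e eqxx andbT (norm12_coprime6 p_pr).
Qed.

Lemma norm12_pairs_odd (p : nat) w : w \in norm12_pairs p -> odd w.1 && odd w.2.
Proof.
rewrite inE => /and3P[c1 c2 _].
have cop (n : nat) : coprime n 6 -> odd n.
  by rewrite -[6%N]/(2 * 3)%N coprimeMr coprimen2 => /andP[].
by rewrite !cop.
Qed.

Lemma norm12_absz (p : nat) (u v : int) :
  (`|u|%N ^ 2 + 11 * `|v|%N ^ 2 = 12 * p)%N <-> u ^+ 2 + 11 * v ^+ 2 = 12 * p%:Z.
Proof.
rewrite -!abszX; have := sqr_ge0 u; have := sqr_ge0 v.
by move: (u ^+ 2) (v ^+ 2) => x y; lia.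
Qed.

(** With a = c + d and b = c - d the two candidate pairs are (|5c - 6d|, |c|) and
    (|5d - 6c|, |d|), and p = 3c^2 - 5cd + 3d^2.  The first qualifies when c is odd, the
    second when d is odd, so exactly one does if a is odd and both do if a is even.
    They can only coincide if |c| = |d|, when p is d^2 or 11 d^2. *)
Lemma odd_card_norm12_pairs (p : nat) (a b : int) : prime p -> odd p -> p <> 11%N ->
  a ^+ 2 + 11 * b ^+ 2 = 4 * p%:Z -> odd #|norm12_pairs p| = odd `|a|.
Proof.
move=> p_pr p_odd p11 eab.
have par := norm4_parity eab.
have [c [d [ac bd]]] : exists c d : int, a = c + d /\ b = c - d.
  by exists ((a + b) %/ 2)%Z, ((a - b) %/ 2)%Z; clear -par; lia.
have pcd : p%:Z = 3 * c ^+ 2 - 5 * c * d + 3 * d ^+ 2.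
  by apply: (mulfI (_ : 4 != 0)) => //; rewrite -eab ac bd; ring.
have sol (w : 'I_(6 * p + 2) * 'I_(6 * p + 2)) : w \in norm12_pairs p ->
    ((w.1 = `|(5 * c - 6 * d)%R|%N :> nat) /\ (w.2 = `|c|%N :> nat)) \/
    ((w.1 = `|(5 * d - 6 * c)%R|%N :> nat) /\ (w.2 = `|d|%N :> nat)).
  rewrite inE => /and3P[_ _ /eqP ew].
  have ew' : w.1%:Z ^+ 2 + 11 * w.2%:Z ^+ 2 = 12 * p%:Z by apply/norm12_absz.
  by have := norm12_solutions p_pr eab ew'; rewrite ac bd; clear; lia.
have norm_sol (x y : int) : p%:Z = 3 * x ^+ 2 - 5 * x * y + 3 * y ^+ 2 ->
    (`|(5 * x - 6 * y)%R|%N ^ 2 + 11 * `|x|%N ^ 2 = 12 * p)%N.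
  by move=> pxy; apply/norm12_absz; rewrite pxy; ring.
have pdc : p%:Z = 3 * d ^+ 2 - 5 * d * c + 3 * c ^+ 2 by rewrite pcd; ring.
have ext w w' : w \in norm12_pairs p -> w' \in norm12_pairs p ->
   w.1 = w'.1 :> nat -> w.2 = w'.2 :> nat -> w = w'.
  by case: w w' => [u v] [u' v'] _ _ /= /val_inj-> /val_inj->.
have odd1 (x y : int) : odd `|x| -> odd `|(5 * x - 6 * y)%R|%N by clear; lia.
have cd_odd : odd `|c| || odd `|d|.
  have [qc qcE] := int_half c.
  have [qd qdE] := int_half d.
  by clear -pcd p_odd qcE qdE; case: qcE pcd => ->; case: qdE => ->; lia.
have a_odd : odd `|a| = (odd `|c| != odd `|d|) by rewrite ac; clear; lia.
rewrite a_odd; have [oc|ec] := boolP (odd `|c|); have [od|ed] := boolP (odd `|d|) => /=.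
- have [w1 w1S [w11 w12]] := mem_norm12_pairs p_pr (odd1 _ _ oc) oc (norm_sol c d pcd).
  have [w2 w2S [w21 w22]] := mem_norm12_pairs p_pr (odd1 _ _ od) od (norm_sol d c pdc).
  have w12' : w1 != w2.
    apply/eqP => ew; have cd2 : `|c|%N = `|d|%N by rewrite -w12 ew w22.
    have [k [kE kp]] : exists k : nat, (k = 1 \/ k = 11)%N /\ p = (k * (`|d| * `|d|))%N.
      have [cd|cd] : c = d \/ c = - d by clear -cd2; lia.
        by exists 1%N; split; [left | move: pcd; rewrite cd; clear; lia].
      by exists 11%N; split; [right | move: pcd; rewrite cd; clear; lia].
    case: kE => kE; rewrite kE in kp.
      have dp : (`|d| %| p)%N by rewrite kp mul1n dvdn_mulr.
      have d1 : `|d|%N != 1%N by apply: contraTneq p_pr => d1; rewrite kp d1.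
      move: (p_pr) => /primeP[_ /(_ _ dp)]; rewrite (negPf d1) /= => /eqP dpE.
      by rewrite dpE in kp; have := prime_gt1 p_pr; clear -kp; nia.
    have : (11 %| p)%N by rewrite kp dvdn_mulr.
    by rewrite dvdn_prime2 // => /eqP e; rewrite -e in p11.
  rewrite (_ : norm12_pairs p = [set w1; w2]) ?cards2 ?w12' //.
  apply/setP => w; apply/idP/idP => [wS | /set2P[]-> //].
  by apply/set2P; case: (sol w wS) => -[h1 h2]; [left | right]; apply: ext => //;
    rewrite ?w11 ?w12 ?w21 ?w22.
- have [w1 w1S [w11 w12]] := mem_norm12_pairs p_pr (odd1 _ _ oc) oc (norm_sol c d pcd).
  rewrite (_ : norm12_pairs p = [set w1]) ?cards1 //.
  apply/setP => w; apply/idP/idP => [wS | /set1P-> //].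
  apply/set1P; case: (sol w wS) => -[h1 h2]; first by apply: ext; rewrite ?w11 ?w12.
  by have := norm12_pairs_odd wS; rewrite h2 (negPf ed) andbF.
- have [w1 w1S [w11 w12]] := mem_norm12_pairs p_pr (odd1 _ _ od) od (norm_sol d c pdc).
  rewrite (_ : norm12_pairs p = [set w1]) ?cards1 //.
  apply/setP => w; apply/idP/idP => [wS | /set1P-> //].
  apply/set1P; case: (sol w wS) => -[h1 h2]; last by apply: ext; rewrite ?w11 ?w12.
  by have := norm12_pairs_odd wS; rewrite h2 (negPf ec) andbF.
by rewrite (negPf ec) (negPf ed) in cd_odd.
Qed.

(** * Square roots of -11 modulo p *)

Lemma Frobenius_fixed (p : nat) (K : finFieldType) (f : {rmorphism 'F_p -> K}) (x : K) :
  prime p -> x ^+ p = x -> exists t, x = f t.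
Proof.
move=> p_pr xp; have := congr1 (map_poly f) (finField_genPoly 'F_p).
rewrite card_Fp // rmorphB /= map_polyXn map_polyX rmorph_prod => /(congr1 (horner^~ x)).
rewrite !hornerE xp subrr horner_prod => /esym/eqP/prodf_eq0[t _].
by rewrite rmorphB /= map_polyX map_polyC !hornerE subr_eq0 => /eqP; exists t.
Qed.

Lemma Fp_intr (p : nat) (t : 'F_p) : prime p -> t = (t : nat)%:~R.
Proof. by move=> p_pr; rewrite -pmulrn natr_Zp. Qed.

(** The Gaussian period y over the squares modulo 11 is a root of X^2 + X + 3, of
    discriminant -11.  Frobenius permutes its terms when p is a square modulo 11, so y
    lies in the prime field and 2y + 1 is a square root of -11. *)
Lemma sqrt_m11_of_residue (p : nat) : prime p -> (p %% 11)%N \in [:: 1; 3; 4; 5; 9]%N ->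
  exists s : int, (p%:Z %| s ^+ 2 + 11)%Z.
Proof.
move=> p_pr p_res.
have p11 : 11%:R != 0 :> 'F_p.
  rewrite -(dvdn_pcharf (pchar_Fp p_pr)) dvdn_prime2 //.
  by apply: contraTneq p_res => ->.
pose P : {poly 'F_p} := \poly_(i < 11) 1.
have szP : size P = 11%N by rewrite size_poly_eq ?oner_neq0.
have [|K [f [z rootz]]] := @finite_extension_root _ P; first by rewrite szP.
have charK : p \in [pchar K] by rewrite (fmorph_pchar f) pchar_Fp.
have z0 : \sum_(i < 11) z ^+ i = 0.
  move/rootP: rootz; rewrite horner_coef size_map_poly szP => eq0; rewrite -[RHS]eq0.
  by apply: eq_bigr => i _; rewrite coef_map coef_poly ltn_ord /= rmorph1 mul1r.
have z11 : z ^+ 11 = 1 by apply/eqP; rewrite -subr_eq0 subrX1 z0 mulr0.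
pose y := z + z ^+ 3 + z ^+ 4 + z ^+ 5 + z ^+ 9.
have y2 : y ^+ 2 + y + 3%:R = 0.
  (* The cofactor is the quotient of y^2 + y + 3 by 1 + z + ... + z^10. *)
  rewrite -[RHS](mulr0 (z ^+ 8 - z ^+ 7 + 2%:R * z ^+ 4 - 2%:R * z + 3%:R)) -z0.
  rewrite !big_ord_recl big_ord0 /= /bump /= /y.
  ring.
have yp : y ^+ p = y.
  rewrite /y -(pFrobenius_autE charK) !rmorphD !rmorphXn /= (pFrobenius_autE charK).
  rewrite -(expr_mod p z11); move: p_res; rewrite !inE.
  have zmod k : z ^+ k = z ^+ (k %% 11) by rewrite expr_mod.
  by case/or4P=> [/eqP->|/eqP->|/eqP->|/orP[]/eqP->]; rewrite -?exprM ?expr1 //;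
    rewrite ![z ^+ (_ * _)]zmod /=; ring.
have [t tE] := Frobenius_fixed f p_pr yp.
exists (2 * (t : nat)%:Z + 1); rewrite (dvdz_pcharf (pchar_Fp p_pr)).
rewrite -(fmorph_eq0 f) rmorph_int rmorphD rmorphXn rmorphD rmorphM /=.
rewrite -(rmorph_int f (Posz t)) -Fp_intr // -tE; apply/eqP.
by rewrite -[RHS](mulr0 4%:R) -y2; ring.
Qed.

(** * The Tribonacci polynomial and its Frobenius *)

Section TribonacciRoots.
Variables (R : fieldType) (a b c : R).
Hypotheses (e1 : a + b + c = 1) (e2 : a * b + b * c + c * a = -1) (e3 : a * b * c = 1).

(** The square root of the discriminant. *)
Definition vandermonde3 := (a - b) * (b - c) * (c - a).

Lemma tribonacci_rec n :
  tribonacci n.+3 = (tribonacci n.+2 + tribonacci n.+1 + tribonacci n)%N.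
Proof. by []. Qed.

Lemma tribonacci_root x : (x - a) * (x - b) * (x - c) = x ^+ 3 - x ^+ 2 - x - 1.
Proof.
have -> : (x - a) * (x - b) * (x - c) =
  x ^+ 3 - (a + b + c) * x ^+ 2 + (a * b + b * c + c * a) * x - a * b * c by ring.
by rewrite e1 e2 e3; ring.
Qed.

Lemma tribonacci_Binet n : (tribonacci n)%:R * vandermonde3 =
  - (a ^+ n.+1 * (b - c) + b ^+ n.+1 * (c - a) + c ^+ n.+1 * (a - b)).
Proof.
have root x : (x - a) * (x - b) * (x - c) = 0 -> x ^+ 3 = x ^+ 2 + x + 1.
  by rewrite tribonacci_root => h; rewrite -[RHS]addr0 -h; ring.
have ra := root a; have rb := root b; have rc := root c.
rewrite subrr !mul0r in ra; rewrite subrr mulr0 mul0r in rb; rewrite subrr mulr0 in rc.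
have step (x : R) m : x ^+ 3 = x ^+ 2 + x + 1 -> x ^+ m.+4 = x ^+ m.+3 + x ^+ m.+2 + x ^+ m.+1.
  by move=> rx; rewrite (exprD x 3 m.+1) rx !exprS; ring.
suffices: [/\ (tribonacci n)%:R * vandermonde3 =
    - (a ^+ n.+1 * (b - c) + b ^+ n.+1 * (c - a) + c ^+ n.+1 * (a - b)),
    (tribonacci n.+1)%:R * vandermonde3 =
    - (a ^+ n.+2 * (b - c) + b ^+ n.+2 * (c - a) + c ^+ n.+2 * (a - b)) &
    (tribonacci n.+2)%:R * vandermonde3 =
    - (a ^+ n.+3 * (b - c) + b ^+ n.+3 * (c - a) + c ^+ n.+3 * (a - b))] by case.
elim: n => [|n [IH0 IH1 IH2]].
  split; rewrite /vandermonde3 /=; try by ring.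
  by rewrite mul1r -[LHS]mulr1 -e1 /vandermonde3; ring.
split=> //; rewrite tribonacci_rec !natrD !mulrDl IH0 IH1 IH2.
by rewrite (step a) ?(step b) ?(step c) ?ra ?rb ?rc //; ring.
Qed.

Lemma vandermonde3_sqr : vandermonde3 ^+ 2 = - 44%:R.
Proof.
have -> : vandermonde3 ^+ 2 = (a + b + c) ^+ 2 * (a * b + b * c + c * a) ^+ 2
    - 4%:R * (a * b + b * c + c * a) ^+ 3 - 4%:R * (a + b + c) ^+ 3 * (a * b * c)
    + 18%:R * (a + b + c) * (a * b + b * c + c * a) * (a * b * c)
    - 27%:R * (a * b * c) ^+ 2 by rewrite /vandermonde3; ring.
by rewrite e1 e2 e3; ring.
Qed.

End TribonacciRoots.

Lemma finite_extension_root_seq (F : finFieldType) (s : seq F) :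
    last 0 s != 0 -> (1 < size s)%N ->
  exists (K : finFieldType) (f : {rmorphism F -> K}) (x : K), horner_rec (map f s) x = 0.
Proof.
move=> s0 s1; have sP : Poly s = s :> seq F := PolyK s0.
have [|K [f [x]]] := @finite_extension_root _ (Poly s); first by rewrite sP.
by rewrite map_Poly_id0 ?rmorph0 // /root horner_Poly => /eqP; exists K, f, x.
Qed.

(** The cube root of unity w is adjoined as well, for the Lagrange resolvents. *)
Lemma tribonacci_splitting_field (p : nat) : prime p ->
  exists (K : finFieldType) (f : {rmorphism 'F_p -> K}) (a b c w : K),
    [/\ a + b + c = 1, a * b + b * c + c * a = -1, a * b * c = 1 & w ^+ 2 + w + 1 = 0].
Proof.
move=> p_pr.
have [|//|K1 [f1 [a /=]]] := @finite_extension_root_seq 'F_p [:: -1; -1; -1; 1].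
  exact: (oner_neq0 'F_p).
rewrite !rmorphN !rmorph1 => ra.
have [|//|K2 [f2 [b /=]]] := @finite_extension_root_seq K1 [:: a ^+ 2 - a - 1; a - 1; 1].
  exact: (oner_neq0 K1).
rewrite !rmorphB rmorphXn !rmorph1 => rb.
have [|//|K [f3 [w /=]]] := @finite_extension_root_seq K2 [:: 1; 1; 1].
  exact: (oner_neq0 K2).
rewrite rmorph1 => rw.
exists K, (f3 \o (f2 \o f1) : {rmorphism 'F_p -> K}).
exists (f3 (f2 a)), (f3 b), (f3 (1 - f2 a - b)), w.
move: ra rb => /(congr1 (f3 \o f2)) /= ra /(congr1 f3).
move: ra; rewrite !(rmorphD, rmorphN, rmorphM, rmorphXn, rmorph1, rmorph0).
move: (f3 (f2 a)) (f3 b) => {}a {}b ra rb; split; last by rewrite -rw; ring.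
- by ring.
- by rewrite -[RHS]subr0 -rb; ring.
transitivity (1 - a * (((0 * b + 1) * b + (a - 1)) * b + (a ^+ 2 - a - 1))
  + ((((0 * a + 1) * a - 1) * a - 1) * a - 1)); first by ring.
by rewrite rb ra mulr0 subr0 addr0.
Qed.

Section FrobeniusOnRoots.
Variables (p : nat) (K : fieldType) (a b c : K).
Hypotheses (charK : p \in [pchar K]) (p2 : p <> 2%N) (p11 : p <> 11%N).
Hypotheses (e1 : a + b + c = 1) (e2 : a * b + b * c + c * a = -1) (e3 : a * b * c = 1).

Let p_pr : prime p := pcharf_prime charK.
Local Notation delta := (vandermonde3 a b c : K).

Let nz q : prime q -> p <> q -> q%:R != 0 :> K.
Proof. by move=> q_pr /eqP neq; apply: natrF_neq0 charK q_pr neq. Qed.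

Lemma vandermonde3_neq0 : delta != 0.
Proof.
rewrite -sqrf_eq0 vandermonde3_sqr // oppr_eq0 (_ : 44 = 2 * 2 * 11)%N // !natrM.
by rewrite !mulf_neq0 ?nz.
Qed.

Lemma Frobenius_root_cases :
  [\/ [/\ a ^+ p = a, b ^+ p = b & c ^+ p = c],
      [/\ a ^+ p = b, b ^+ p = c & c ^+ p = a],
      [/\ a ^+ p = c, b ^+ p = a & c ^+ p = b] |
      delta ^+ p = - delta /\
      [\/ [/\ a ^+ p = a, b ^+ p = c & c ^+ p = b],
          [/\ a ^+ p = b, b ^+ p = a & c ^+ p = c] |
          [/\ a ^+ p = c, b ^+ p = b & c ^+ p = a]]].
Proof.
have rootP x : x ^+ 3 - x ^+ 2 - x - 1 = 0 -> [\/ x ^+ p = a, x ^+ p = b | x ^+ p = c].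
  move=> rx; have : (x ^+ p - a) * (x ^+ p - b) * (x ^+ p - c) = 0.
    have := congr1 (pFrobenius_aut charK) rx.
    by rewrite tribonacci_root // !rmorphB !rmorphXn rmorph1 rmorph0 /= pFrobenius_autE.
  move/eqP; rewrite !mulf_eq0 !subr_eq0 => /orP[/orP[]|] /eqP ->;
    [by constructor 1 | by constructor 2 | by constructor 3].
have ra : a ^+ 3 - a ^+ 2 - a - 1 = 0 by rewrite -(tribonacci_root e1 e2 e3); ring.
have rb : b ^+ 3 - b ^+ 2 - b - 1 = 0 by rewrite -(tribonacci_root e1 e2 e3); ring.
have rc : c ^+ 3 - c ^+ 2 - c - 1 = 0 by rewrite -(tribonacci_root e1 e2 e3); ring.
have inj (s t : K) : s ^+ p = t ^+ p -> s = t.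
  by rewrite -!(pFrobenius_autE charK) => /fmorph_inj.
have := vandermonde3_neq0; rewrite !mulf_eq0 !subr_eq0 !negb_or => /andP[/andP[ab bc] ca].
have nab : a ^+ p <> b ^+ p by move/inj/eqP; apply/negP.
have nbc : b ^+ p <> c ^+ p by move/inj/eqP; apply/negP.
have nca : c ^+ p <> a ^+ p by move/inj/eqP; apply/negP.
have dp : delta ^+ p = (a ^+ p - b ^+ p) * (b ^+ p - c ^+ p) * (c ^+ p - a ^+ p).
  by rewrite -!(pFrobenius_autE charK) /vandermonde3 !rmorphM !rmorphB.
case: (rootP a ra) => ea; case: (rootP b rb) => eb; case: (rootP c rc) => ec;
  try (by case: nab; rewrite ea eb); try (by case: nbc; rewrite eb ec);
  try (by case: nca; rewrite ec ea); rewrite ea eb ec in dp *.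
- by constructor 1.
- by constructor 4; split; [apply: etrans dp _; rewrite /vandermonde3; ring | constructor 1].
- by constructor 4; split; [apply: etrans dp _; rewrite /vandermonde3; ring | constructor 2].
- by constructor 2.
- by constructor 3.
- by constructor 4; split; [apply: etrans dp _; rewrite /vandermonde3; ring | constructor 3].
Qed.

(** In Binet's formula for T_(p-1) the roots appear to the power p.  A cyclic permutation
    gives 4 or -4 as numerator.  A transposition that fixes a gives (b - c)(3a - 1), and
    3a = 1 would imply 38 = 0. *)
Lemma tribonacci_dvd_Frobenius : p <> 19%N ->
  (p %| tribonacci p.-1)%N <-> [/\ a ^+ p = a, b ^+ p = b & c ^+ p = c].
Proof.
move=> p19; have d0 := vandermonde3_neq0.
have := tribonacci_Binet e1 e2 e3 p.-1; rewrite prednK ?prime_gt0 // => binet.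
have key : (p %| tribonacci p.-1)%N =
    (a ^+ p * (b - c) + b ^+ p * (c - a) + c ^+ p * (a - b) == 0).
  by rewrite (dvdn_pcharf charK) -[RHS]oppr_eq0 -binet mulf_eq0 (negPf d0) orbF.
rewrite key; split=> [/eqP h|[-> -> ->]]; last by apply/eqP; ring.
have n2 : 2%:R != 0 :> K by apply: nz.
have n4 : 4%:R != 0 :> K by rewrite (natrM _ 2 2) mulf_neq0.
have n38 : 38%:R != 0 :> K by rewrite (natrM _ 2 19) mulf_neq0 ?nz.
have cyc : (a + b + c) ^+ 2 - 3%:R * (a * b + b * c + c * a) = 4%:R by rewrite e1 e2; ring.
have third x : (x - a) * (x - b) * (x - c) = 0 -> 3%:R * x <> 1.
  rewrite tribonacci_root // => rx x3; case/eqP: n38.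
  transitivity ((1 - (3%:R * x) ^+ 3) + 3%:R * ((3%:R * x) ^+ 2 - 1) + 9%:R * (3%:R * x - 1)
     + 27%:R * (x ^+ 3 - x ^+ 2 - x - 1) + 38%:R); first by rewrite rx x3; ring.
  by ring.
have := d0; rewrite !mulf_eq0 !negb_or => /andP[/andP[ab bc] ca].
case: Frobenius_root_cases => [//|[ea eb ec]|[ea eb ec]|[_ [] [ea eb ec]]];
  rewrite ea eb ec in h; exfalso.
- by case/eqP: n4; rewrite -cyc -h; ring.
- by case/eqP: n4; rewrite -cyc -[RHS]oppr0 -h; ring.
- have : (b - c) * (3%:R * a - (a + b + c)) = 0 by rewrite -[RHS]h; ring.
  move/eqP; rewrite e1 mulf_eq0 (negPf bc) subr_eq0 => /eqP; apply: third; ring.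
- have : (a - b) * (3%:R * c - (a + b + c)) = 0 by rewrite -[RHS]h; ring.
  move/eqP; rewrite e1 mulf_eq0 (negPf ab) subr_eq0 => /eqP; apply: third; ring.
have : (c - a) * (3%:R * b - (a + b + c)) = 0 by rewrite -[RHS]h; ring.
move/eqP; rewrite e1 mulf_eq0 (negPf ca) subr_eq0 => /eqP; apply: third; ring.
Qed.

End FrobeniusOnRoots.

(** The cubes of the Lagrange resolvents u and v are the two conjugates A and B of
    19 + 3 sqrt(-3) sqrt(-11), in some order, so k = 0 means that u and v have the same
    (p^2 - 1)-th power.  This holds if Frobenius is trivial on the roots; if it is a
    3-cycle, its square multiplies u and v by different cube roots of unity.
    Transpositions are excluded because s, hence the discriminant's square root, is fixed
    by Frobenius. *)
Lemma Frobenius_cubic_character (p : nat) (K : fieldType) (a b c w s : K) (k : 'Z_3) :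
    p \in [pchar K] -> p <> 2%N -> p <> 3%N -> p <> 11%N ->
    a + b + c = 1 -> a * b + b * c + c * a = -1 -> a * b * c = 1 ->
    w ^+ 2 + w + 1 = 0 -> s ^+ 2 = - 11%:R -> s ^+ p = s ->
    let m := ((p ^ 2).-1 %/ 3)%N in let r := 1 + 2%:R * w in
    (19%:R + 3%:R * r * s) ^+ m = w ^+ k * (19%:R - 3%:R * r * s) ^+ m ->
  [/\ a ^+ p = a, b ^+ p = b & c ^+ p = c] <-> k = 0.
Proof.
move=> charK p2 /eqP p3 p11 e1 e2 e3 w0 s2 sp m r.
have p_pr : prime p := pcharf_prime charK.
have K3 : 3%:R != 0 :> K by apply: natrF_neq0 charK _ _.
have K2 : 2%:R != 0 :> K by apply: natrF_neq0 charK _ _ => //; apply/eqP.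
have w3 := cube_root1 w0.
have p2E : (p ^ 2 = 3 * m + 1)%N := sqr_mod3 p_pr p3.
pose u := a + w * b + w ^+ 2 * c; pose v := a + w ^+ 2 * b + w * c.
pose d := vandermonde3 a b c.
have d2 : d ^+ 2 = - 44%:R by apply: vandermonde3_sqr.
have d0 : d != 0 by apply: vandermonde3_neq0 charK _ _ _ _ _.
have wE : w ^+ 2 = - w - 1 by rewrite -[RHS]addr0 -w0; ring.
have uE : u = a + w * b + (- w - 1) * c by rewrite /u wE.
have vE : v = a + (- w - 1) * b + w * c by rewrite /v wE.
have uv : u * v = 4%:R.
  transitivity ((a + b + c) ^+ 2 - 3%:R * (a * b + b * c + c * a)); last first.
    by rewrite e1 e2; ring.
  transitivity ((a + b + c) ^+ 2 - 3%:R * (a * b + b * c + c * a)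
    - (b - c) ^+ 2 * (w ^+ 2 + w + 1)).
    by rewrite uE vE; ring.
  by rewrite w0 mulr0 subr0.
have wv : w * v = w * a + b + w ^+ 2 * c.
  by transitivity (w * a + w ^+ 3 * b + w ^+ 2 * c); [rewrite /v; ring | rewrite w3 mul1r].
have w2v : w ^+ 2 * v = w ^+ 2 * a + w * b + c.
  transitivity (w ^+ 2 * a + w * w ^+ 3 * b + w ^+ 3 * c); first by rewrite /v; ring.
  by rewrite w3 mul1r mulr1.
have subr3 (x y : K) : x ^+ 3 - y ^+ 3 = (x - y) * (x - w * y) * (x - w ^+ 2 * y).
  transitivity ((x - y) * (x - w * y) * (x - w ^+ 2 * y)
      + (w ^+ 2 + w + 1) * (x ^+ 2 * y - w * x * y ^+ 2 - (1 - w) * y ^+ 3)); first by ring.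
  by rewrite w0 mul0r addr0.
have u3B : u ^+ 3 - v ^+ 3 = - 3%:R * r * d.
  rewrite subr3 wv w2v.
  have -> : u - v = r * (b - c) by rewrite /u /v /r wE; ring.
  have -> : u - (w * a + b + w ^+ 2 * c) = (1 - w) * (a - b) by rewrite /u; ring.
  have -> : u - (w ^+ 2 * a + w * b + c) = (w ^+ 2 - 1) * (c - a) by rewrite /u; ring.
  transitivity (r * d * (1 - w) * (w ^+ 2 - 1)); first by rewrite /d /vandermonde3; ring.
  transitivity (r * d * ((w ^+ 2 + w + 1) - (w ^+ 3 - 1) - 3%:R)); first by ring.
  by rewrite w0 w3; ring.
have u3D : u ^+ 3 + v ^+ 3 = 38%:R.
  transitivity (u ^+ 3 - (- v) ^+ 3); first by ring.
  rewrite subr3 !mulrN !opprK wv w2v.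
  have -> : u + v = 2%:R * a - b - c by rewrite /u /v wE; ring.
  have -> : u + (w * a + b + w ^+ 2 * c) = - w ^+ 2 * (a + b - 2%:R * c).
    by rewrite /u wE; ring.
  have -> : u + (w ^+ 2 * a + w * b + c) = - w * (a + c - 2%:R * b) by rewrite /u wE; ring.
  transitivity (w ^+ 3 * (2%:R * (a + b + c) ^+ 3
    - 9%:R * (a + b + c) * (a * b + b * c + c * a) + 27%:R * (a * b * c))); first by ring.
  by rewrite w3 e1 e2 e3; ring.
have [u0 v0] : u != 0 /\ v != 0.
  apply/andP; rewrite -negb_or -mulf_eq0 uv (natrM _ 2 2) mulf_neq0 //.
have phiE x : x ^+ p = pFrobenius_aut charK x by rewrite pFrobenius_autE.
have wp2 : w ^+ (p ^ 2) = w by rewrite p2E exprD exprM w3 expr1n mul1r.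
have pp x : x ^+ (p ^ 2) = (x ^+ p) ^+ p by rewrite -exprM mulnn.
have up2 : u ^+ (p ^ 2) = a ^+ (p ^ 2) + w * b ^+ (p ^ 2) + w ^+ 2 * c ^+ (p ^ 2).
  have -> : w * b ^+ (p ^ 2) = (w * b) ^+ (p ^ 2) by rewrite exprMn wp2.
  have -> : w ^+ 2 * c ^+ (p ^ 2) = (w ^+ 2 * c) ^+ (p ^ 2) by rewrite exprMn exprAC wp2.
  by rewrite !pp !phiE -!rmorphD.
have vp2 : v ^+ (p ^ 2) = a ^+ (p ^ 2) + w ^+ 2 * b ^+ (p ^ 2) + w * c ^+ (p ^ 2).
  have -> : w * c ^+ (p ^ 2) = (w * c) ^+ (p ^ 2) by rewrite exprMn wp2.
  have -> : w ^+ 2 * b ^+ (p ^ 2) = (w ^+ 2 * b) ^+ (p ^ 2) by rewrite exprMn exprAC wp2.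
  by rewrite !pp !phiE -!rmorphD.
have ds : d = 2%:R * s \/ d = - (2%:R * s).
  have : (d - 2%:R * s) * (d + 2%:R * s) = 0.
    by transitivity (d ^+ 2 - 4%:R * s ^+ 2); [ring | rewrite d2 s2; ring].
  by move/eqP; rewrite mulf_eq0 subr_eq0 addr_eq0 => /orP[] /eqP; [left | right].
have dp : d ^+ p = d.
  have sp' : (2%:R * s) ^+ p = 2%:R * s by rewrite exprMn sp phiE rmorph_nat.
  by case: ds => ->; rewrite ?sp' // phiE rmorphN /= -phiE sp'.
pose A := 19%:R + 3%:R * r * s; pose B := 19%:R - 3%:R * r * s.
have uvAB : (u ^+ 3 = A /\ v ^+ 3 = B) \/ (u ^+ 3 = B /\ v ^+ 3 = A).
  have half (x y z : K) : x + y = 38%:R -> x - y = 2%:R * z -> x = 19%:R + z /\ y = 19%:R - z.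
    move=> hD hB; split; apply: (mulfI K2).
      by transitivity ((x + y) + (x - y)); [ring | rewrite hD hB; ring].
    by transitivity ((x + y) - (x - y)); [ring | rewrite hD hB; ring].
  case: ds => dE; [right | left].
    have [|-> ->] := half _ _ (- (3%:R * r * s)) u3D; first by rewrite u3B dE; ring.
    by rewrite /A /B opprK.
  by have [|-> ->] := half _ _ (3%:R * r * s) u3D; first by rewrite u3B dE; ring.
have powM x : x != 0 -> x ^+ (p ^ 2) = (x ^+ 3) ^+ m * x.
  by move=> _; rewrite p2E exprD exprM expr1.
move=> AB.
have [A0 B0] : A != 0 /\ B != 0.
  by case: uvAB => -[<- <-]; rewrite !expf_neq0.
have AmBm : (A ^+ m = B ^+ m) <-> k = 0.
  have Bm0 : B ^+ m != 0 by rewrite expf_neq0.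
  rewrite AB -[X in _ = X <-> _]mul1r; split=> [/(mulIf Bm0) wk | ->].
    exact: (exprZ3_inj (j := 0) K3 w0 wk).
  by rewrite expr0.
rewrite -AmBm; apply: (iff_trans (B := u ^+ (p ^ 2) * v = v ^+ (p ^ 2) * u)); last first.
  rewrite !powM //; have -> : (u ^+ 3) ^+ m * u * v = (u ^+ 3) ^+ m * (u * v) by ring.
  have -> : (v ^+ 3) ^+ m * v * u = (v ^+ 3) ^+ m * (u * v) by ring.
  have uv0 : u * v != 0 by rewrite mulf_neq0.
  by split; [move/(mulIf uv0) | move=> AmB; congr (_ * _); move: AmB];
    case: uvAB => -[-> ->].
have w1 := cube_root_neq1 K3 w0.
have wu : w * u = w * a + w ^+ 2 * b + c.
  by transitivity (w * a + w ^+ 2 * b + w ^+ 3 * c); [rewrite /u; ring | rewrite w3 mul1r].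
have w2u : w ^+ 2 * u = w ^+ 2 * a + b + w * c.
  transitivity (w ^+ 2 * a + w ^+ 3 * b + w * w ^+ 3 * c); first by rewrite /u; ring.
  by rewrite w3 mul1r mulr1.
have w_neq0 : w != 0 by apply: contraTneq (oner_neq0 K) => w_0; rewrite -w3 w_0 expr0n eqxx.
have wuv : w * u * v <> w ^+ 2 * v * u.
  move=> e; case/eqP: w1; apply: (mulfI (mulf_neq0 w_neq0 (mulf_neq0 u0 v0))).
  by transitivity (w ^+ 2 * v * u); [ring | rewrite -e; ring].
rewrite up2 vp2 !pp; split=> [[ea eb ec]|]; first by rewrite !(ea, eb, ec) mulrC.
have [//|[ea eb ec]|[ea eb ec]|[dN _]] := Frobenius_root_cases charK p2 p11 e1 e2 e3.
- rewrite !(ea, eb, ec) => h; case: wuv.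
  transitivity ((c + w * a + w ^+ 2 * b) * v); first by rewrite wu; ring.
  by rewrite h w2v; ring.
- rewrite !(ea, eb, ec) => h; case: wuv.
  transitivity (w * v * u); first by ring.
  transitivity ((b + w ^+ 2 * c + w * a) * u); first by rewrite wv; ring.
  rewrite -h; transitivity (w ^+ 2 * u * v); last by ring.
  by rewrite w2u; ring.
case/eqP: d0; apply: (mulfI K2); rewrite mulr0.
by transitivity (d + d); [ring | rewrite -{1}dp dN addNr].
Qed.

(** * The cubic character attached to a norm *)

Lemma finite_field_cube_root (q : nat) : prime q ->
  exists (F : finFieldType) (w : F), q \in [pchar F] /\ w ^+ 2 + w + 1 = 0.
Proof.
move=> q_pr.
have [|//|F [f [w /=]]] := @finite_extension_root_seq 'F_q [:: 1; 1; 1].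
  exact: (oner_neq0 'F_q).
rewrite rmorph1 => rw; exists F, w; split; first by rewrite (fmorph_pchar f) pchar_Fp.
by rewrite -rw; ring.
Qed.

Section CubicCharacterOfP.

Variables (p e : nat) (X Y Z : int).
Hypotheses (p_pr : prime p) (p2 : p <> 2%N) (p3 : p <> 3%N).
Hypotheses (eXY : X ^+ 2 + 11 * Y ^+ 2 = 4 * p%:Z * 27 ^+ e) (Y3 : ~~ (3 %| Y)%Z).
Hypothesis ZE : 2 * Z = 19 * Y + 3 * X.

Let r : int * int := (Z, 3 * X).
Let N := (27 ^ e.+1 * p + 16 * (`|Y| * `|Y|))%N.

(** rho = Z + 3X w is (19Y + 3 sqrt(-3) X)/2. *)
Lemma resolvent_norm : eis_norm r = 27 ^+ e.+1 * p%:Z + 16 * Y ^+ 2.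
Proof.
apply: (mulfI (_ : 4 != 0)) => //; rewrite /eis_norm /=.
transitivity ((2 * Z) ^+ 2 - 6 * X * (2 * Z) + 36 * X ^+ 2); first by ring.
rewrite ZE [27 ^+ e.+1]exprS.
transitivity (27 * (X ^+ 2 + 11 * Y ^+ 2) + 64 * Y ^+ 2); first by ring.
by rewrite eXY; ring.
Qed.

Lemma absz_resolvent_norm : `|eis_norm r|%N = N.
Proof.
apply/eqP; rewrite -eqz_nat abszE ger0_norm ?eis_norm_ge0 // resolvent_norm /N.
rewrite PoszD !PoszM !abszE -normrM ger0_norm -?expr2 ?sqr_ge0 //.
by rewrite -[Posz (_ ^ _)]natz natrX eqxx.
Qed.

(** Otherwise p^2 would divide 4p 27^e. *)
Lemma resolvent_p_ndvd : ~~ (p%:Z %| Y)%Z.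
Proof.
apply/negP => pY; have pX : (p%:Z %| X)%Z.
  have : (p%:Z %| X * X)%Z.
    have -> : X * X = p%:Z * (4 * 27 ^+ e) - Y * (11 * Y).
      by transitivity (X ^+ 2 + 11 * Y ^+ 2 - 11 * Y ^+ 2); [ring | rewrite eXY; ring].
    by rewrite rpredB // dvdz_mulr.
  by rewrite dvdz_primeM // orbb.
case/dvdzP: pX => x xE; case/dvdzP: pY => y yE.
have p0 : p%:Z != 0 by rewrite -lt0n prime_gt0.
have : p%:Z * (x ^+ 2 + 11 * y ^+ 2) = 4 * 27 ^+ e.
  apply: (mulfI p0); move: eXY; rewrite xE yE => h.
  by transitivity (4 * p%:Z * 27 ^+ e); [rewrite -h|]; ring.
move/(congr1 (fun z => (p%:Z %| z)%Z)); rewrite dvdz_mulr // => /esym.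
rewrite dvdz_primeM // !dvdzE abszX -[`|4|%N]/(2 ^ 2)%N -[`|27|%N]/(3 ^ 3)%N => /orP[].
  by rewrite Euclid_dvdX // dvdn_prime2 // => /andP[/eqP].
by rewrite -expnM Euclid_dvdX // dvdn_prime2 // => /andP[/eqP].
Qed.

Lemma coprime_resolvent_3 : coprime 3 N.
Proof.
rewrite prime_coprime // /N dvdn_addr; last by rewrite expnS -mulnA dvdn_mulr.
by rewrite !Euclid_dvdM //= orbb; move: Y3; rewrite dvdzE.
Qed.

Lemma coprime_resolvent_p : coprime p N.
Proof.
rewrite prime_coprime // /N dvdn_addr; last by rewrite dvdn_mull.
rewrite (_ : 16 = 2 ^ 4)%N // Euclid_dvdM // [X in _ || X]Euclid_dvdM // orbb.
rewrite Euclid_dvdX // dvdn_prime2 // andbT.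
by move: resolvent_p_ndvd; rewrite dvdzE => /negPf->; rewrite orbF; apply/eqP.
Qed.

Lemma odd_resolvent_norm : odd N.
Proof.
have op : odd p by have [/p2|] := even_prime p_pr.
by rewrite /N oddD !oddM oddX op.
Qed.

Lemma coprime_resolvent_Y : coprime `|Y| N.
Proof.
rewrite /N addnC mulnA /coprime gcdnMDl -/(coprime _ _) coprimeMr.
rewrite (_ : 27 ^ _ = 3 ^ (3 * e.+1))%N; last by rewrite expnM.
rewrite coprime_sym coprimeXl /=; last first.
  by rewrite prime_coprime //; move: Y3; rewrite dvdzE.
by rewrite coprime_sym prime_coprime //; move: resolvent_p_ndvd; rewrite dvdzE.
Qed.

Variable chi : nat -> 'Z_3.
Hypothesis chiP : cubic_symbol r chi.

Let chiM m n : coprime m N -> coprime n N -> chi (m * n)%N = chi m + chi n.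
Proof. by case: chiP => + _ _; rewrite absz_resolvent_norm => h; apply: h. Qed.

Let chi1 : chi 1 = 0.
Proof.
have := @chiM 1 1 (coprime1n _) (coprime1n _).
by rewrite muln1 -{1}[chi 1]addr0 => /addrI.
Qed.

Let chiX m n : coprime m N -> chi (m ^ n)%N = chi m *+ n.
Proof.
move=> mN; elim: n => [|n IHn]; first by rewrite expn0 chi1.
by rewrite expnS chiM ?coprimeXl // IHn mulrS.
Qed.

Let Z3_3 (x : 'Z_3) : x *+ 3 = 0.
Proof. by case: x => [[|[|[|]]]] lt //; apply: val_inj. Qed.

(** The trace of rho is 19Y, so rho / conj rho is -1 modulo q.  Its (q^2 - 1)/3-th power
    is 1, since this exponent is even for q odd, and -1 = 1 for q = 2. *)
Lemma cubic_symbol_dvd_trace q : prime q -> (q%:Z %| Y)%Z -> chi q = 0.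
Proof.
move=> q_pr qY.
have qN : coprime q N by apply: coprime_dvdl coprime_resolvent_Y; move: qY; rewrite dvdzE.
have q3 : q != 3%N by apply: contraNneq Y3 => q_3; move: qY; rewrite q_3.
have [F [w [charF w0]]] := finite_field_cube_root q_pr.
have [_ _ /(_ q q_pr q3)] := chiP; rewrite absz_resolvent_norm => /(_ qN F w charF w0).
have ev0 : eis_eval w r * eis_eval (w ^+ 2) r != 0.
  rewrite eis_eval_norm // -(dvdz_pcharf charF) dvdzE absz_resolvent_norm.
  by rewrite -prime_coprime.
have trace0 : eis_eval w r = - eis_eval (w ^+ 2) r.
  apply/eqP; rewrite -subr_eq0 opprK; apply/eqP.
  transitivity ((2 * Z - 3 * X)%:~R + (3 * X)%:~R * (w ^+ 2 + w + 1)).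
    by rewrite /eis_eval /= !(rmorphB, rmorphM) /=; ring.
  rewrite w0 mulr0 addr0 ZE addrK; apply/eqP.
  by rewrite -(dvdz_pcharf charF) dvdz_mull.
have F3 : 3%:R != 0 :> F by apply: natrF_neq0 charF _ q3.
rewrite trace0; set x := eis_eval (w ^+ 2) r in ev0 trace0 *; set m := (_ %/ 3)%N => eqx.
have x0 : x ^+ m != 0.
  by rewrite expf_neq0 //; apply: contraNneq ev0 => ->; rewrite mulr0.
have xN : (- x) ^+ m = x ^+ m.
  have [q2|q_odd] := even_prime q_pr.
    congr (_ ^+ _); apply/eqP; rewrite eq_sym -subr_eq0 opprK -mulr2n -mulr_natl.
    by rewrite -q2 (pcharf0 charF) mul0r.
  have m_even : ~~ odd m.
    have := congr1 odd (sqr_mod3 q_pr q3); rewrite oddD oddM oddX q_odd /= -/m.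
    by case: (odd m).
  by rewrite -[m]odd_double_half (negPf m_even) add0n -mul2n !exprM sqrrN.
have xk : 1 = w ^+ chi q by apply: (mulIf x0); rewrite mul1r -eqx xN.
by apply/esym; apply: (exprZ3_inj (i := 0) F3 w0); rewrite expr0.
Qed.

Lemma cubic_symbol_Y : chi `|Y| = 0.
Proof.
have Y0 : (0 < `|Y|)%N by rewrite absz_gt0; apply: contraNneq Y3 => ->; rewrite dvdz0.
suffices all n : (0 < n)%N -> (n %| `|Y|)%N -> chi n = 0 by apply: all.
elim: n.+1 {-2}n (ltnSn n) => // k IHk {}n lenk n0 nY.
have [n1|n1] := leqP n 1; first by rewrite (_ : n = 1%N) //; lia.
have q_pr := pdiv_prime n1; have [d dE] := dvdnP (pdiv_dvd n).
have qY := dvdn_trans (pdiv_dvd n) nY.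
have dY : (d %| `|Y|)%N by apply: dvdn_trans nY; rewrite dE dvdn_mulr.
have d0 : (0 < d)%N by move: n0; rewrite dE muln_gt0 => /andP[].
rewrite dE chiM ?(coprime_dvdl _ coprime_resolvent_Y) //.
rewrite (cubic_symbol_dvd_trace q_pr) ?dvdzE // addr0 IHk //.
by apply: leq_trans (_ : n <= k)%N; rewrite // [in X in (_ < X)%N]dE ltn_Pmulr ?prime_gt1.
Qed.

(** The norm is the sum of 27^(e+1) p and 16 Y^2, so these have the same symbol; powers of
    27 and the factor Y^2 contribute 0, and 16 = 2^3 * 2. *)
Lemma cubic_symbol_p : chi p = chi 2.
Proof.
have pN := coprime_resolvent_p; have c3 := coprime_resolvent_3; have cY := coprime_resolvent_Y.
have c2 : coprime 2 N by rewrite coprime2n odd_resolvent_norm.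
have [_ + _] := chiP; rewrite absz_resolvent_norm.
move=> /(_ (27 ^ e.+1 * p) (16 * (`|Y| * `|Y|)))%N.
rewrite coprimeMl pN (_ : 27 ^ _ = (3 ^ e.+1) ^ 3)%N; last by rewrite -expnM mulnC expnM.
rewrite !coprimeXl //= => /(_ isT).
rewrite (_ : (3 ^ _) ^ 3 = 27 ^ e.+1)%N; last by rewrite -expnM mulnC expnM.
move=> /(_ (dvdnn _)).
rewrite (_ : 27 ^ _ = (3 ^ e.+1) ^ 3)%N; last by rewrite -expnM mulnC expnM.
rewrite chiM ?coprimeXl // chiX ?coprimeXl // Z3_3 add0r => ->.
rewrite (_ : 16 = 2 ^ 4)%N // chiM ?coprimeXl ?coprimeMl ?cY // chiM // cubic_symbol_Y.
by rewrite !addr0 chiX // mulrS Z3_3 addr0.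
Qed.

(** Modulo 2 the exponent (q^2 - 1)/3 is 1, and rho is equal to its conjugate exactly when
    its second coordinate 3X is even. *)
Lemma cubic_symbol_p_eq0 : chi p = 0 <-> ~~ odd `|Y|.
Proof.
have par : odd `|X| = odd `|Y|.
  by have := ZE; clear; lia.
rewrite cubic_symbol_p; split; last first.
  by move=> Yev; apply: cubic_symbol_dvd_trace => //; rewrite dvdzE dvdn2.
apply: contra_eqN => Yodd.
have [F [w [charF w0]]] := finite_field_cube_root (isT : prime 2).
have c2 : coprime 2 N by rewrite coprime2n odd_resolvent_norm.
have [_ _ /(_ 2 isT isT)] := chiP; rewrite absz_resolvent_norm => /(_ c2 F w charF w0).
rewrite /= !expr1; apply: contra_eq_neq => ->; rewrite expr0 mul1r.
have F2 : 2%:R = 0 :> F := pcharf0 charF.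
rewrite -subr_eq0 (_ : _ - _ = (3 * X)%:~R * (1 + 2%:R * w - (w ^+ 2 + w + 1))); last first.
  by rewrite /eis_eval /=; ring.
rewrite F2 w0 mul0r addr0 subr0 mulr1 -(dvdz_pcharf charF) dvdzE abszM Euclid_dvdM //=.
by rewrite dvdn2 par Yodd.
Qed.

End CubicCharacterOfP.

(** * The three conditions *)

(** If 3 divides b, multiply a + b sqrt(-11) by 4 - sqrt(-11), which up to sign and
    conjugation is the cube of (1 + sqrt(-11))/2. *)
Lemma norm_scaled_coprime3 (p : nat) (a b : int) : prime p -> p <> 3%N ->
    a ^+ 2 + 11 * b ^+ 2 = 4 * p%:Z ->
  exists e X Y Z, [/\ X ^+ 2 + 11 * Y ^+ 2 = 4 * p%:Z * 27 ^+ e, ~~ (3 %| Y)%Z,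
    2 * Z = 19 * Y + 3 * X & odd `|Y| = odd `|a|].
Proof.
move=> p_pr p3 eab.
have par := norm4_parity eab.
have [b3|b3] := boolP (3 %| b)%Z; last first.
  exists 0, a, b, ((19 * b + 3 * a) %/ 2)%Z.
  by rewrite expr0 mulr1 eab par; split=> //; clear -par; lia.
have a3 : ~~ (3 %| a)%Z.
  apply/negP => a3; case/dvdzP: a3 => x xE; case/dvdzP: b3 => y yE.
  have : (3 %| 4 * p%:Z)%Z.
    by rewrite -eab xE yE; apply/dvdzP; exists (3 * (x ^+ 2 + 11 * y ^+ 2)); ring.
  rewrite (dvdz_primeM _ _ (isT : prime 3)) => /orP[//|].
  by rewrite dvdzE dvdn_prime2 // => /eqP e; case: p3.
exists 1, (4 * a + 11 * b), (4 * b - a), ((19 * (4 * b - a) + 3 * (4 * a + 11 * b)) %/ 2)%Z.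
split.
- by transitivity (27 * (a ^+ 2 + 11 * b ^+ 2)); [ring | rewrite eab; ring].
- apply: contraNN a3 => h; have -> : a = 4 * b - (4 * b - a) by ring.
  by rewrite rpredB // dvdz_mull.
- by clear -par; lia.
by clear; lia.
Qed.

Section Tribonacci.
Variable p : nat.
Hypotheses (p_pr : prime p) (p2 : p <> 2%N) (p11 : p <> 11%N) (p19 : p <> 19%N).

(** With s = X/Y as square root of -11 modulo p, the numbers 19 + 3 sqrt(-3) s and
    19 - 3 sqrt(-3) s are rho and its conjugate up to the common factor 2/Y. *)
Lemma tribonacci_dvd_even (a b : int) : p <> 3%N -> a ^+ 2 + 11 * b ^+ 2 = 4 * p%:Z ->
  (p %| tribonacci p.-1)%N <-> ~~ odd `|a|.
Proof.
move=> p3 eab.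
have [e [X [Y [Z [eXY Y3 ZE <-]]]]] := norm_scaled_coprime3 p_pr p3 eab.
have [K [f [ra [rb [rc [w [e1 e2 e3 w0]]]]]]] := tribonacci_splitting_field p_pr.
have charK : p \in [pchar K] by rewrite (fmorph_pchar f) pchar_Fp.
have NE := resolvent_norm eXY ZE.
have [||chi chiP] := @cubic_reciprocity (Z, 3 * X).
- by rewrite dvdz_mulr.
- rewrite NE exprS -!mulrA rpredDl; last by rewrite dvdz_mulr.
  by rewrite !expr2 !(dvdz_primeM _ _ (isT : prime 3)) orbb.
rewrite -(cubic_symbol_p_eq0 p_pr p2 p3 eXY Y3 ZE chiP).
rewrite (tribonacci_dvd_Frobenius charK p2 p11 e1 e2 e3 p19).
have Y0 : Y%:~R != 0 :> K by rewrite -(dvdz_pcharf charK) (resolvent_p_ndvd p_pr p2 p3 eXY).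
have K2 : 2%:R != 0 :> K by apply: natrF_neq0 charK _ _ => //; apply/eqP.
pose s : K := X%:~R / Y%:~R.
have phiE x : x ^+ p = pFrobenius_aut charK x by rewrite pFrobenius_autE.
have s2 : s ^+ 2 = - 11%:R.
  have : X%:~R ^+ 2 + 11%:R * Y%:~R ^+ 2 = 0 :> K.
    move/(congr1 (fun z : int => z%:~R : K)): eXY.
    rewrite !(rmorphD, rmorphM, rmorphXn) /= => ->.
    by rewrite -pmulrn (pcharf0 charK) mulr0 mul0r.
  move=> h; rewrite /s exprMn exprVn; apply: (canLR (mulfK _)); first by rewrite expf_neq0.
  by rewrite -[RHS]add0r -h; ring.
have sp : s ^+ p = s by rewrite /s phiE rmorphM fmorphV !rmorph_int.
apply: (Frobenius_cubic_character charK p2 p3 p11 e1 e2 e3 w0 s2 sp).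
have [_ _ /(_ p p_pr _ _ K w charK w0)] := chiP.
rewrite (absz_resolvent_norm eXY ZE).
move=> /(_ (introN eqP p3) (coprime_resolvent_p p_pr p2 p3 eXY)).
set m := (_ %/ 3)%N => rec.
have ZK : 2%:R * Z%:~R = 19%:R * Y%:~R + 3%:R * X%:~R :> K.
  by move/(congr1 (fun z : int => z%:~R : K)): ZE; rewrite !(rmorphD, rmorphM).
have sY : s * Y%:~R = X%:~R by rewrite /s divfK.
have w2 : w ^+ 2 = - w - 1 by rewrite -[RHS]addr0 -w0; ring.
have AE : 19%:R + 3%:R * (1 + 2%:R * w) * s = 2%:R / Y%:~R * eis_eval w (Z, 3 * X).
  rewrite [RHS]mulrAC; apply: (canRL (mulfK Y0)).
  by rewrite /eis_eval /= [RHS]mulrDr ZK rmorphM /= -sY; ring.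
have BE : 19%:R - 3%:R * (1 + 2%:R * w) * s = 2%:R / Y%:~R * eis_eval (w ^+ 2) (Z, 3 * X).
  rewrite [RHS]mulrAC; apply: (canRL (mulfK Y0)).
  by rewrite /eis_eval /= [RHS]mulrDr ZK rmorphM /= -sY w2; ring.
by rewrite AE BE !exprMn rec mulrCA.
Qed.

Lemma sqrt_m11_of_tribonacci : (p %| tribonacci p.-1)%N ->
  exists s : int, (p%:Z %| s ^+ 2 + 11)%Z.
Proof.
have [K [f [a [b [c [w [e1 e2 e3 w0]]]]]]] := tribonacci_splitting_field p_pr.
have charK : p \in [pchar K] by rewrite (fmorph_pchar f) pchar_Fp.
move/(tribonacci_dvd_Frobenius charK p2 p11 e1 e2 e3 p19) => [ea eb ec].
have K2 : 2%:R != 0 :> K by apply: natrF_neq0 charK _ _ => //; apply/eqP.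
pose d : K := vandermonde3 a b c / 2%:R.
have dp : d ^+ p = d.
  rewrite /d /vandermonde3 -(pFrobenius_autE charK) fmorph_div !rmorphM !rmorphB rmorph_nat /=.
  by rewrite !pFrobenius_autE ea eb ec.
have d2 : d ^+ 2 = - 11%:R.
  rewrite /d exprMn exprVn (vandermonde3_sqr e1 e2 e3).
  apply: (canLR (mulfK _)); first by rewrite expf_neq0.
  by ring.
have [t tE] := Frobenius_fixed f p_pr dp.
exists (t : nat); rewrite (dvdz_pcharf (pchar_Fp p_pr)) rmorphD rmorphXn /= -Fp_intr //.
by rewrite -(fmorph_eq0 f) rmorphD rmorphXn -tE d2 rmorph_int addNr.
Qed.

End Tribonacci.

Theorem corollary1p2 (p : nat)
    (p_prime : prime p) (p_neq2 : p <> 2%N) (p_neq11 : p <> 11%N) (p_neq19 : p <> 19%N) :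
  [<-> (tribonacci p.-1 = 0 %[mod p])%N;
       exists x y : int, p%:Z = x ^+ 2 + 11 * y ^+ 2;
       (newform11_coef p = 0 %[mod 2])%Z /\
         (p %% 11)%N \in [:: 1; 3; 4; 5; 9]%N ].
Proof.
have p_odd : odd p by have [/p_neq2|] := even_prime p_prime.
have norm s : (p%:Z %| s ^+ 2 + 11)%Z -> exists a b : int, a ^+ 2 + 11 * b ^+ 2 = 4 * p%:Z.
  by apply: norm4_of_sqrt_m11 => //; have := prime_gt0 p_prime; lia.
have coefE : (newform11_coef p = 0 %[mod 2])%Z <-> ~~ odd #|norm12_pairs p|.
  rewrite -dvdn2 (dvdn_pcharf (pchar_Fp (isT : prime 2))) -newform11_coef_mod2.
  rewrite -(dvdz_pcharf (pchar_Fp (isT : prime 2))).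
  by split=> [/eqP|h]; last apply/eqP; rewrite eqz_mod_dvd subr0.
have even_norm (a b : int) : a ^+ 2 + 11 * b ^+ 2 = 4 * p%:Z -> ~~ odd `|a| ->
    exists x y : int, p%:Z = x ^+ 2 + 11 * y ^+ 2.
  move=> eab a_even; have [x xE] : exists x, a = 2 * x.
    by exists (a %/ 2)%Z; clear -a_even; lia.
  have [y yE] : exists y, b = 2 * y.
    have [y [yE|yE]] := int_half b; first by exists y.
    by exfalso; clear -xE yE eab; move: eab; rewrite xE yE; lia.
  by exists x, y; apply: (mulfI (_ : 4 != 0)) => //; rewrite -eab xE yE; ring.
tfae.
- move=> /eqP; rewrite mod0n => pT.
  have [s sP] := sqrt_m11_of_tribonacci p_prime p_neq2 p_neq11 p_neq19 pT.
  have [a [b eab]] := norm s sP.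
  have p3 : p <> 3%N by move=> p3; rewrite p3 in pT.
  apply: (even_norm a b eab).
  by apply/(tribonacci_dvd_even p_prime p_neq2 p_neq11 p_neq19 p3 eab).
- move=> [x [y pE]].
  have eab : (2 * x) ^+ 2 + 11 * (2 * y) ^+ 2 = 4 * p%:Z by rewrite pE; ring.
  split.
    by apply/coefE; rewrite (odd_card_norm12_pairs p_prime p_odd p_neq11 eab) abszM oddM.
  have x11 : ~~ (11%N%:Z %| x)%Z.
    apply/negP => x11; have : (11%N%:Z %| p%:Z)%Z.
      by rewrite pE expr2 rpredD // ?dvdz_mulr // dvdz_mulr.
    by rewrite dvdzE dvdn_prime2 // => /eqP e; case: p_neq11.
  have pmod : (p %% 11 = (`|x| * `|x|) %% 11)%N.
    apply/eqP; rewrite -eqz_nat -!modz_nat pE PoszM !abszE -normrM.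
    rewrite ger0_norm -?expr2 ?sqr_ge0 //.
    by rewrite addrC mulrC modzMDl.
  rewrite pmod -modnMm; move: x11; rewrite dvdzE /dvdn.
  by move: (_ %% 11)%N (ltn_pmod `|x| (isT : (0 < 11)%N)); do 11?case=> //.
move=> [/coefE ev res].
have [s sP] := sqrt_m11_of_residue p_prime res.
have [a [b eab]] := norm s sP.
rewrite (odd_card_norm12_pairs p_prime p_odd p_neq11 eab) in ev.
have p3 : p <> 3%N.
  move=> p3; have [x [y pE]] := even_norm a b eab ev; rewrite p3 in pE.
  have y0 : y ^+ 2 = 0 by have := sqr_ge0 x; have := sqr_ge0 y; clear -pE; lia.
  have : x ^+ 2 = 3 by rewrite y0 in pE; clear -pE; lia.
  by have [q [->|->]] := int_half x; clear; lia.
have := (tribonacci_dvd_even p_prime p_neq2 p_neq11 p_neq19 p3 eab).2 ev.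
by rewrite /dvdn mod0n => /eqP.
Qed.
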